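(* Fix a pseudofunctor $U:\mathcal D\to\mathcal C$ between 2-categories. The following are equivalent for a collection of 1-cells $\{y_A:A\to UFA\}_{A\in\mathcal C}$ of $\mathcal C$ (where $FA$ is an object of $\mathcal D$ for each $A\in\mathcal C$): (i) the collection $(y_A)$ is coherently closed for $U$-extensions and satisfies the composition and unit axioms; (ii) there is a colax adjunction $(\Psi,\Phi):(\epsilon,\eta)$ exhibiting $F$ as left colax adjoint to $U$, for which $\Psi$ is invertible, $F$ is a pseudofunctor (with object assignment $A\mapsto FA$) and the 1-cell component of the unit $\eta$ at each $A\in\mathcal C$ equals $y_A$.
   Context: Conventions. For a pseudofunctor $H$ the structure 2-cells are written $\gamma:H(gf)\Rightarrow Hg\circ Hf$ and $\iota:H1_A\Rightarrow 1_{HA}$ (invertible). A colax natural transformation $\alpha:H\Rightarrow G$ consists of 1-cells $\alpha_A:HA\to GA$ and 2-cells $\alpha_f:\alpha_B\circ Hf\Rightarrow Gf\circ\alpha_A$ for $f:A\to B$, subject to the usual unit, composition and local naturality axioms. A modification $\Gamma:\alpha\to\beta$ is a family of 2-cells $\Gamma_A:\alpha_A\Rightarrow\beta_A$ with $(Gf\,\Gamma_A)\circ\alpha_f=\beta_f\circ(\Gamma_B\,Hf)$. For a pseudofunctor $K$, $K\alpha$ has 1-cell components $K\alpha_A$ and 2-cell components $\gamma\circ K(\alpha_f)\circ\gamma^{-1}$. Colax adjunction. A colax adjunction $(\Psi,\Phi):(\epsilon,\eta)$ exhibiting $F:\mathcal X\to\mathcal Y$ as left colax adjoint to $U:\mathcal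 Y\to\mathcal X$ consists of pseudofunctors $F,U$, colax natural transformations $\eta:1_{\mathcal X}\Rightarrow UF$ (unit), $\epsilon:FU\Rightarrow 1_{\mathcal Y}$ and modifications $\Psi:\epsilon F\circ F\eta\to 1_F$, $\Phi:1_U\to U\epsilon\circ\eta U$ such that for all $A\in\mathcal X$, $B\in\mathcal Y$ the following composites are identities (swallowtail identities): $$\eta_A\xrightarrow{\Phi_{FA}\eta_A}U\epsilon_{FA}\,\eta_{UFA}\,\eta_A\xrightarrow{U\epsilon_{FA}\,\eta_{\eta_A}}U\epsilon_{FA}\,UF\eta_A\,\eta_A\xrightarrow{(U\Psi)_A\eta_A}\eta_A,$$ $$\epsilon_B\xrightarrow{\epsilon_B(F\Phi)_B}\epsilon_B\,FU\epsilon_B\,F\eta_{UB}\xrightarrow{\epsilon_{\epsilon_B}F\eta_{UB}}\epsilon_B\,\epsilon_{FUB}\,F\eta_{UB}\xrightarrow{\epsilon_B\Psi_{UB}}\epsilon_B,$$ where $(U\Psi)_A=\iota\circ U\Psi_A\circ\gamma^{-1}$ and $(F\Phi)_B=\gamma\circ F\Phi_B\circ\iota^{-1}$. $U$-extensions. Let $U:\mathcal D\to\mathcal C$ be a pseudofunctor, $y_A:A\to UFA$ and $f:A\to UB$ 1-cells of $\mathcal C$ (with $FA,B\in\mathcal D$). A left $U$-extension (or just $U$-extension) of $f$ along $y_A$ is a pair $(f',\psi_f)$ of a 1-cell $f':FA\to B$ of $\mathcal D$ and a 2-cell $\psi_f:f\Rightarrow Uf'\circ y_A$ such that for every pair $(g:FA\to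 B,\ \alpha:f\Rightarrow Ug\circ y_A)$ there is a unique 2-cell $\theta:f'\Rightarrow g$ with $(U\theta\,y_A)\circ\psi_f=\alpha$. The collection $(y_A:A\to UFA)_{A\in\mathcal C}$ is coherently closed for $U$-extensions if: (a) for every $f:A\to UB$ there is a chosen $U$-extension $(f^{\mathbb D},\mathbb D_f)$ of $f$ along $y_A$; (b) for every $f:X\to UY$ the 1-cell $1_{UY}^{\mathbb D}\circ(y_{UY}f)^{\mathbb D}:FX\to Y$ together with the 2-cell $$f\xrightarrow{\mathbb D_{1_{UY}}f}U1_{UY}^{\mathbb D}\,y_{UY}f\xrightarrow{U1_{UY}^{\mathbb D}\,\mathbb D_{y_{UY}f}}U1_{UY}^{\mathbb D}\,U(y_{UY}f)^{\mathbb D}\,y_X\xrightarrow{\gamma^{-1}y_X}U\big(1_{UY}^{\mathbb D}(y_{UY}f)^{\mathbb D}\big)y_X$$ is a $U$-extension of $f$ along $y_X$. Unit axiom: for every $A$, the pair $(1_{FA},\ \iota^{-1}y_A:y_A\Rightarrow U1_{FA}\circ y_A)$ is a $U$-extension of $y_A$ along $y_A$. Composition axiom: for all $f:A\to B$, $g:B\to C$ in $\mathcal C$, the 1-cell $(y_Cg)^{\mathbb D}(y_Bf)^{\mathbb D}$ with the 2-cell $$y_Cgf\xrightarrow{\mathbb D_{y_Cg}f}U(y_Cg)^{\mathbb D}y_Bf\xrightarrow{U(y_Cg)^{\mathbb D}\mathbb D_{y_Bf}}U(y_Cg)^{\mathbb D}U(y_Bf)^{\mathbb D}y_A\xrightarrow{\gamma^{-1}y_A}U\big((y_Cg)^{\mathbb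 D}(y_Bf)^{\mathbb D}\big)y_A$$ is a $U$-extension of $y_Cgf$ along $y_A$. *)

(* Defs.v *)
Set Implicit Arguments.
Unset Strict Implicit.
Unset Printing Implicit Defensive.

Declare Scope two_scope.
Delimit Scope two_scope with two.
Open Scope two_scope.

Reserved Notation "x ⟹ y" (at level 70, no associativity).
Reserved Notation "b • a" (at level 55, right associativity).
Reserved Notation "g ∘ f" (at level 40, left associativity).
Reserved Notation "b ⋆ a" (at level 45, no associativity).
Reserved Notation "h ◁ a" (at level 45, no associativity).
Reserved Notation "a ▷ f" (at level 45, no associativity).
Reserved Notation "H @1 f" (at level 30, no associativity).
Reserved Notation "H @2 a" (at level 30, no associativity).

(** * Strict 2-categories *)

Record category := Category {
  obj :> Type;
  mor : obj -> obj -> Type;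
  idm : forall x, mor x x;
  vcomp : forall x y z, mor y z -> mor x y -> mor x z;
  vcomp_assoc : forall x y z w (c : mor z w) (b : mor y z) (a : mor x y),
    vcomp c (vcomp b a) = vcomp (vcomp c b) a;
  vcomp_idl : forall x y (a : mor x y), vcomp (idm y) a = a;
  vcomp_idr : forall x y (a : mor x y), vcomp a (idm x) = a
}.

Arguments idm {_} x.
Arguments vcomp {_ x y z} _ _.
Notation "x ⟹ y" := (mor x y) : two_scope.
Notation "b • a" := (vcomp b a) : two_scope.

(* The identity 2-cell between 1-cells that are equal, but possibly only
   propositionally so.  All strictness constraints are stated through it.
   Uniqueness of identity proofs is assumed in using these definitions:
   [eqm e] is meant not to depend on [e]. *)
Definition eqm {K : category} {x y : K} (e : x = y) : x ⟹ y :=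
  match e in _ = z return x ⟹ z with eq_refl => idm x end.

Record two_category := TwoCategory {
  ob :> Type;
  hom : ob -> ob -> category;
  id1 : forall A, hom A A;
  comp1 : forall A B C, hom B C -> hom A B -> hom A C;
  hcomp : forall A B C (g g' : hom B C) (f f' : hom A B),
    g ⟹ g' -> f ⟹ f' -> comp1 g f ⟹ comp1 g' f';
  hcomp_id : forall A B C (g : hom B C) (f : hom A B),
    hcomp (idm g) (idm f) = idm (comp1 g f);
  interchange : forall A B C (g g' g'' : hom B C) (f f' f'' : hom A B)
      (b' : g' ⟹ g'') (b : g ⟹ g') (a' : f' ⟹ f'') (a : f ⟹ f'),
    hcomp (b' • b) (a' • a) = hcomp b' a' • hcomp b a;
  comp1_assoc : forall A B C D (h : hom C D) (g : hom B C) (f : hom A B),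
    comp1 h (comp1 g f) = comp1 (comp1 h g) f;
  comp1_idl : forall A B (f : hom A B), comp1 (id1 B) f = f;
  comp1_idr : forall A B (f : hom A B), comp1 f (id1 A) = f;
  hcomp_assoc : forall A B C D (h h' : hom C D) (g g' : hom B C)
      (f f' : hom A B) (c : h ⟹ h') (b : g ⟹ g') (a : f ⟹ f'),
    eqm (comp1_assoc h' g' f') • hcomp c (hcomp b a)
    = hcomp (hcomp c b) a • eqm (comp1_assoc h g f);
  hcomp_idl : forall A B (f f' : hom A B) (a : f ⟹ f'),
    eqm (comp1_idl f') • hcomp (idm (id1 B)) a = a • eqm (comp1_idl f);
  hcomp_idr : forall A B (f f' : hom A B) (a : f ⟹ f'),
    eqm (comp1_idr f') • hcomp a (idm (id1 A)) = a • eqm (comp1_idr f)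
}.

Arguments hom {t} A B.
Arguments id1 {t} A.
Arguments comp1 {t A B C} _ _.
Arguments hcomp {t A B C g g' f f'} _ _.
Arguments comp1_assoc {t A B C D} _ _ _.
Arguments comp1_idl {t A B} _.
Arguments comp1_idr {t A B} _.

Notation "g ∘ f" := (comp1 g f) : two_scope.
Notation "b ⋆ a" := (hcomp b a) : two_scope.
Notation "h ◁ a" := (hcomp (idm h) a) : two_scope.
Notation "a ▷ f" := (hcomp a (idm f)) : two_scope.

Section Strictness.
Context {X : two_category} {A B C D : X}.
Implicit Types (h : hom C D) (g : hom B C) (f : hom A B).

Definition asc h g f : h ∘ (g ∘ f) ⟹ (h ∘ g) ∘ f := eqm (comp1_assoc h g f).
Definition asc' h g f : (h ∘ g) ∘ f ⟹ h ∘ (g ∘ f) :=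
  eqm (eq_sym (comp1_assoc h g f)).
Definition lun f : id1 B ∘ f ⟹ f := eqm (comp1_idl f).
Definition lun' f : f ⟹ id1 B ∘ f := eqm (eq_sym (comp1_idl f)).
Definition run f : f ∘ id1 A ⟹ f := eqm (comp1_idr f).
Definition run' f : f ⟹ f ∘ id1 A := eqm (eq_sym (comp1_idr f)).

End Strictness.

(** * Pseudofunctors *)

(* The object assignment [H0] is a parameter, so that a pseudofunctor can be
   required to have a prescribed one.  [gam'] and [iot'] are the inverses of
   the structure 2-cells. *)
Record pseudo_data {X Y : two_category} (H0 : X -> Y) := PseudoData {
  on1 : forall A B, hom A B -> hom (H0 A) (H0 B);
  on2 : forall A B (f f' : hom A B), f ⟹ f' -> on1 f ⟹ on1 f';
  gam : forall A B C (g : hom B C) (f : hom A B), on1 (g ∘ f) ⟹ on1 g ∘ on1 f;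
  gam' : forall A B C (g : hom B C) (f : hom A B), on1 g ∘ on1 f ⟹ on1 (g ∘ f);
  iot : forall A, on1 (id1 A) ⟹ id1 (H0 A);
  iot' : forall A, id1 (H0 A) ⟹ on1 (id1 A)
}.

Arguments on1 {X Y H0} p {A B} _.
Arguments on2 {X Y H0} p {A B f f'} _.
Arguments gam {X Y H0} p {A B C} g f.
Arguments gam' {X Y H0} p {A B C} g f.
Arguments iot {X Y H0} p A.
Arguments iot' {X Y H0} p A.

Notation "H @1 f" := (on1 H f) : two_scope.
Notation "H @2 a" := (on2 H a) : two_scope.

Record is_pseudofunctor {X Y : two_category} {H0 : X -> Y}
    (H : pseudo_data H0) : Prop := {
  on2_id : forall (A B : X) (f : hom A B), H @2 (idm f) = idm (H @1 f);
  on2_comp : forall (A B : X) (f f' f'' : hom A B) (b : f' ⟹ f'') (a : f ⟹ f'),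
    H @2 (b • a) = H @2 b • H @2 a;
  gamK : forall (A B C : X) (g : hom B C) (f : hom A B),
    gam' H g f • gam H g f = idm _;
  gam'K : forall (A B C : X) (g : hom B C) (f : hom A B),
    gam H g f • gam' H g f = idm _;
  iotK : forall A : X, iot' H A • iot H A = idm _;
  iot'K : forall A : X, iot H A • iot' H A = idm _;
  gam_nat : forall (A B C : X) (g g' : hom B C) (f f' : hom A B)
      (b : g ⟹ g') (a : f ⟹ f'),
    gam H g' f' • H @2 (b ⋆ a) = ((H @2 b) ⋆ (H @2 a)) • gam H g f;
  gam_assoc : forall (A B C D : X) (h : hom C D) (g : hom B C) (f : hom A B),
    (gam H h g ▷ (H @1 f)) • gam H (h ∘ g) f • H @2 (asc h g f)
    = asc _ _ _ • ((H @1 h) ◁ gam H g f) • gam H h (g ∘ f);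
  gam_idl : forall (A B : X) (f : hom A B),
    lun _ • (iot H B ▷ (H @1 f)) • gam H (id1 B) f = H @2 (lun f);
  gam_idr : forall (A B : X) (f : hom A B),
    run _ • ((H @1 f) ◁ iot H A) • gam H f (id1 A) = H @2 (run f)
}.

Record pseudofunctor {X Y : two_category} (H0 : X -> Y) := Pseudofunctor {
  pf_data :> pseudo_data H0;
  pf_laws : is_pseudofunctor pf_data
}.

Definition id_pf (X : two_category) : pseudo_data (fun A : X => A) := {|
  on1 := fun A B f => f;
  on2 := fun A B f f' a => a;
  gam := fun A B C g f => idm (g ∘ f);
  gam' := fun A B C g f => idm (g ∘ f);
  iot := fun A => idm (id1 A);
  iot' := fun A => idm (id1 A)
|}.

Definition comp_pf {X Y Z : two_category} {K0 : Y -> Z} {H0 : X -> Y}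
    (K : pseudo_data K0) (H : pseudo_data H0) :
    pseudo_data (fun A => K0 (H0 A)) := {|
  on1 := fun A B f => K @1 (H @1 f);
  on2 := fun A B f f' a => K @2 (H @2 a);
  gam := fun A B C g f => gam K (H @1 g) (H @1 f) • K @2 (gam H g f);
  gam' := fun A B C g f => K @2 (gam' H g f) • gam' K (H @1 g) (H @1 f);
  iot := fun A => iot K (H0 A) • K @2 (iot H A);
  iot' := fun A => K @2 (iot' H A) • iot' K (H0 A)
|}.

(** * Colax natural transformations and modifications *)

(* The components of a colax transformation and the modification axiom depend
   on source and target only through their actions on objects and 1-cells.
   Indexing the data by these actions makes composites of pseudofunctors
   strictly associative and unital here, so that (εF)(Fη) below needs no
   coercion between F(UF) and (FU)F.  The axioms, in [is_colax], refer to the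
   full pseudofunctor structure. *)
Definition act1 {X Y : two_category} (H0 : X -> Y) : Type :=
  forall A B : X, hom A B -> hom (H0 A) (H0 B).

Record colax_data {X Y : two_category} {H0 G0 : X -> Y}
    (H1 : act1 H0) (G1 : act1 G0) := ColaxData {
  cell1 :> forall A : X, hom (H0 A) (G0 A);
  cell2 : forall (A B : X) (f : hom A B),
    cell1 B ∘ H1 A B f ⟹ G1 A B f ∘ cell1 A
}.

Arguments cell2 {X Y H0 G0 H1 G1} c {A B} f.

Record is_colax {X Y : two_category} {H0 G0 : X -> Y}
    (H : pseudo_data H0) (G : pseudo_data G0)
    (α : colax_data (@on1 _ _ _ H) (@on1 _ _ _ G)) : Prop := {
  colax_nat : forall (A B : X) (f f' : hom A B) (θ : f ⟹ f'),
    cell2 α f' • (α B ◁ (H @2 θ)) = ((G @2 θ) ▷ α A) • cell2 α f;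
  colax_unit : forall A : X,
    lun _ • (iot G A ▷ α A) • cell2 α (id1 A) = run _ • (α A ◁ iot H A);
  colax_comp : forall (A B C : X) (g : hom B C) (f : hom A B),
    (gam G g f ▷ α A) • cell2 α (g ∘ f)
    = asc _ _ _ • ((G @1 g) ◁ cell2 α f) • asc' _ _ _
      • (cell2 α g ▷ (H @1 f)) • asc _ _ _ • (α C ◁ gam H g f)
}.

Record colax {X Y : two_category} {H0 G0 : X -> Y}
    (H : pseudo_data H0) (G : pseudo_data G0) := Colax {
  colax_of :> colax_data (@on1 _ _ _ H) (@on1 _ _ _ G);
  colax_laws : is_colax colax_of
}.

Definition id_colax {X Y : two_category} {H0 : X -> Y} (H1 : act1 H0) :
    colax_data H1 H1 := {|
  cell1 := fun A => id1 (H0 A);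
  cell2 := fun A B f => run' (H1 A B f) • lun (H1 A B f)
|}.

Definition comp_colax {X Y : two_category} {H0 G0 K0 : X -> Y}
    {H1 : act1 H0} {G1 : act1 G0} {K1 : act1 K0}
    (β : colax_data G1 K1) (α : colax_data H1 G1) : colax_data H1 K1 := {|
  cell1 := fun A => β A ∘ α A;
  cell2 := fun A B f =>
    asc' _ _ _ • (cell2 β f ▷ α A) • asc _ _ _
    • (β B ◁ cell2 α f) • asc' _ _ _
|}.

Definition whisk_l {X Y Z : two_category} {H0 G0 : X -> Y} {K0 : Y -> Z}
    {H1 : act1 H0} {G1 : act1 G0}
    (K : pseudo_data K0) (α : colax_data H1 G1) :
    colax_data (H0 := fun A => K0 (H0 A)) (G0 := fun A => K0 (G0 A))
      (fun A B f => K @1 H1 A B f) (fun A B f => K @1 G1 A B f) := {|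
  cell1 := fun A => K @1 α A;
  cell2 := fun A B f => gam K _ _ • K @2 (cell2 α f) • gam' K _ _
|}.

Definition whisk_r {W X Y : two_category} {H0 G0 : X -> Y} {L0 : W -> X}
    {H1 : act1 H0} {G1 : act1 G0}
    (α : colax_data H1 G1) (L : pseudo_data L0) :
    colax_data (H0 := fun A => H0 (L0 A)) (G0 := fun A => G0 (L0 A))
      (fun A B f => H1 _ _ (L @1 f)) (fun A B f => G1 _ _ (L @1 f)) := {|
  cell1 := fun A => α (L0 A);
  cell2 := fun A B f => cell2 α (L @1 f)
|}.

Record modification {X Y : two_category} {H0 G0 : X -> Y}
    {H1 : act1 H0} {G1 : act1 G0} (α β : colax_data H1 G1) := Modification {
  mcell :> forall A : X, α A ⟹ β A;
  mod_law : forall (A B : X) (f : hom A B),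
    (G1 A B f ◁ mcell A) • cell2 α f = cell2 β f • (mcell B ▷ H1 A B f)
}.

Definition invertible_modification {X Y : two_category} {H0 G0 : X -> Y}
    {H1 : act1 H0} {G1 : act1 G0} {α β : colax_data H1 G1}
    (Γ : modification α β) : Prop :=
  exists Δ : modification β α,
    forall A : X, Δ A • Γ A = idm (α A) /\ Γ A • Δ A = idm (β A).

(** * Colax adjunctions *)

Record colax_adjunction {X Y : two_category} {F0 : X -> Y} {U0 : Y -> X}
    (F : pseudofunctor F0) (U : pseudofunctor U0) := ColaxAdjunction {
  adj_unit : colax (id_pf X) (comp_pf U F);
  adj_counit : colax (comp_pf F U) (id_pf Y);
  adj_Psi :
    modification (comp_colax (whisk_r adj_counit F) (whisk_l F adj_unit))
      (id_colax (@on1 _ _ _ F));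
  adj_Phi :
    modification (id_colax (@on1 _ _ _ U))
      (comp_colax (whisk_l U adj_counit) (whisk_r adj_unit U));
  swallowtail_unit : forall A : X,
    let η := adj_unit in let ε := adj_counit in
    let UΨ := iot U (F0 A) • U @2 adj_Psi A • gam' U (ε (F0 A)) (F @1 η A) in
    lun (η A)
      • (UΨ ▷ η A)
      • asc (U @1 ε (F0 A)) (U @1 (F @1 η A)) (η A)
      • ((U @1 ε (F0 A)) ◁ cell2 η (η A))
      • asc' (U @1 ε (F0 A)) (η (U0 (F0 A))) (η A)
      • (adj_Phi (F0 A) ▷ η A)
      • lun' (η A)
    = idm (η A);
  swallowtail_counit : forall B : Y,
    let η := adj_unit in let ε := adj_counit in
    let FΦ := gam F (U @1 ε B) (η (U0 B)) • F @2 adj_Phi B • iot' F (U0 B) in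
    run (ε B)
      • (ε B ◁ adj_Psi (U0 B))
      • asc' (ε B) (ε (F0 (U0 B))) (F @1 η (U0 B))
      • (cell2 ε (ε B) ▷ (F @1 η (U0 B)))
      • asc (ε B) (F @1 (U @1 ε B)) (F @1 η (U0 B))
      • (ε B ◁ FΦ)
      • run' (ε B)
    = idm (ε B)
}.

(** * U-extensions *)

Section UExtensions.
Context {D C : two_category} {U0 : D -> C} (U : pseudofunctor U0).
Context {F0 : C -> D} (y : forall A : C, hom A (U0 (F0 A))).

(* The pair (f', ψ) is a left U-extension of f along y_A. *)
Definition is_U_extension {A : C} {B : D} (f : hom A (U0 B))
    (f' : hom (F0 A) B) (ψ : f ⟹ (U @1 f') ∘ y A) : Prop :=
  forall (g : hom (F0 A) B) (α : f ⟹ (U @1 g) ∘ y A),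
    exists! θ : f' ⟹ g, ((U @2 θ) ▷ y A) • ψ = α.

Record chosen_U_extensions := ChosenUExtensions {
  ext : forall (A : C) (B : D), hom A (U0 B) -> hom (F0 A) B;
  ext_cell : forall (A : C) (B : D) (f : hom A (U0 B)),
    f ⟹ (U @1 ext f) ∘ y A;
  ext_universal : forall (A : C) (B : D) (f : hom A (U0 B)),
    is_U_extension (ext_cell f)
}.

(* The pasting of σ : h ⟹ Uk y_B with τ : y_B f ⟹ Ul y_A. *)
Definition paste_ext {A B : C} {Z : D} {f : hom A B} {h : hom B (U0 Z)}
    {k : hom (F0 B) Z} {l : hom (F0 A) (F0 B)}
    (σ : h ⟹ (U @1 k) ∘ y B) (τ : y B ∘ f ⟹ (U @1 l) ∘ y A) :
    h ∘ f ⟹ (U @1 (k ∘ l)) ∘ y A :=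
  (gam' U k l ▷ y A) • asc (U @1 k) (U @1 l) (y A) • ((U @1 k) ◁ τ)
    • asc' (U @1 k) (y B) f • (σ ▷ f).

(* The closure of the choice 𝔻 under the composites 1_{UZ}^𝔻 (y_{UZ} f)^𝔻. *)
Definition coherent_choice (d : chosen_U_extensions) : Prop :=
  forall (A : C) (Z : D) (f : hom A (U0 Z)),
    is_U_extension
      (f' := ext d (id1 (U0 Z)) ∘ ext d (y (U0 Z) ∘ f))
      (paste_ext (ext_cell d (id1 (U0 Z))) (ext_cell d (y (U0 Z) ∘ f))
         • lun' f).

Definition unit_axiom : Prop :=
  forall A : C,
    is_U_extension (f' := id1 (F0 A)) ((iot' U (F0 A) ▷ y A) • lun' (y A)).

Definition composition_axiom (d : chosen_U_extensions) : Prop :=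
  forall (A B Z : C) (f : hom A B) (g : hom B Z),
    is_U_extension
      (f' := ext d (y Z ∘ g) ∘ ext d (y B ∘ f))
      (paste_ext (ext_cell d (y Z ∘ g)) (ext_cell d (y B ∘ f))).

End UExtensions.

(* Main.v *)
From Stdlib Require Import Eqdep FunctionalExtensionality PropExtensionality
  IndefiniteDescription.
Require Import Defs.

(** Extensions along y_A amount to a left adjoint f |-> f^D of the functor
    g |-> Ug ∘ y_A between the hom-categories D(FA, B) and C(A, UB).  The theorem
    says when these local adjoints come from a colax adjunction; the link is the
    formula f^D = ε ∘ Ff, with exhibiting 2-cell the pasting of Φ with the unit
    η_f ([mate]).

    Given an adjunction, a 2-cell α : f ⟹ Ug ∘ y_A has the transpose
    ε Ff ⟹ ε FUg F(y_A) ⟹ g ε F(y_A) ⟹ g, built from Fα, ε_g and Ψ.  The first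
    swallowtail identity gives that pushing the mate of f along the transpose
    returns α ([transpose_mate]).  For uniqueness, transposition is natural, and
    the transpose of a mate is the identity by the second swallowtail identity and
    the modification axiom of Ψ ([transpose_mate_id]).  The unit axiom and the two
    closure conditions hold because the composites in question are isomorphic to
    such extensions, compatibly with the exhibiting 2-cells; here the invertibility
    of Ψ is used.

    Conversely, put Ff = (y_B f)^D, ε_B = (1_UB)^D, η_f = 𝔻_{y_B f}
    and Φ_B = 𝔻_{1_UB}.  Coherent closure says that ε ∘ Ff is an extension of f, the
    unit axiom that 1_FA is one of y_A, and the composition axiom that Fg ∘ Ff is
    one of y_C g f.  So the action of F on 2-cells, its constraints, the cells ε_f
    and Ψ are all induced by universal properties, those between two extensions of
    the same 1-cell are invertible, and every axiom of a colax adjunction can be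
    checked after pushing an exhibiting 2-cell along both sides.

    In both directions the computations take place with 2-cells h ⟹ Uk ∘ y_A, which
    are closed under pushing along 2-cells k ⟹ k', under the action of 1-cells of D,
    and under pasting.  The coherence of U is used only to show that these
    operations are associative and unital ([act_comp], [paste_assoc],
    [paste_unit_l], [act_unit]). *)

Set Implicit Arguments.
Unset Strict Implicit.
Unset Printing Implicit Defensive.

(** * Identity 2-cells between equal 1-cells *)

Lemma eqm_irr {K : category} {x y : K} (p q : x = y) : eqm p = eqm q.
Proof. now rewrite (UIP _ _ _ p q). Qed.

Lemma eqm_idm {K : category} {x : K} (p : x = x) : eqm p = idm x.
Proof. exact (eqm_irr p eq_refl). Qed.

Lemma eqm_comp {K : category} {x y z : K} (p : x = y) (q : y = z) :
  eqm q • eqm p = eqm (eq_trans p q).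
Proof. destruct q, p. apply vcomp_idl. Qed.

Lemma eqm_comp_l {K : category} {x y z w : K} (p : y = z) (q : z = w)
    (a : x ⟹ y) : eqm q • eqm p • a = eqm (eq_trans p q) • a.
Proof. now rewrite vcomp_assoc, eqm_comp. Qed.

Lemma eqm_whl {X : two_category} {A B C : X} (g : hom B C) (f f' : hom A B)
    (p : f = f') : g ◁ eqm p = eqm (f_equal (comp1 g) p).
Proof. destruct p. apply hcomp_id. Qed.

Lemma eqm_whr {X : two_category} {A B C : X} (g g' : hom B C) (f : hom A B)
    (p : g = g') : eqm p ▷ f = eqm (f_equal (fun g => g ∘ f) p).
Proof. destruct p. apply hcomp_id. Qed.

Lemma whl_comp {X : two_category} {A B C : X} (g : hom B C) {f f' f'' : hom A B}
    (b : f' ⟹ f'') (a : f ⟹ f') : g ◁ (b • a) = (g ◁ b) • (g ◁ a).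
Proof. now rewrite <- interchange, vcomp_idl. Qed.

Lemma whr_comp {X : two_category} {A B C : X} {g g' g'' : hom B C} (f : hom A B)
    (b : g' ⟹ g'') (a : g ⟹ g') : (b • a) ▷ f = (b ▷ f) • (a ▷ f).
Proof. now rewrite <- interchange, vcomp_idl. Qed.

Lemma hcomp_lr {X : two_category} {A B C : X} {g g' : hom B C} {f f' : hom A B}
    (b : g ⟹ g') (a : f ⟹ f') : b ⋆ a = (b ▷ f') • (g ◁ a).
Proof. now rewrite <- interchange, vcomp_idl, vcomp_idr. Qed.

Lemma hcomp_rl {X : two_category} {A B C : X} {g g' : hom B C} {f f' : hom A B}
    (b : g ⟹ g') (a : f ⟹ f') : b ⋆ a = (g' ◁ a) • (b ▷ f).
Proof. now rewrite <- interchange, vcomp_idl, vcomp_idr. Qed.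

Lemma slide {X : two_category} {A B C : X} {g g' : hom B C} {f f' : hom A B}
    (b : g ⟹ g') (a : f ⟹ f') : (b ▷ f') • (g ◁ a) = (g' ◁ a) • (b ▷ f).
Proof. now rewrite <- hcomp_lr, hcomp_rl. Qed.

Section StrictnessInverse.
Context {X : two_category} {A B C D : X}.
Implicit Types (h : hom C D) (g : hom B C) (f : hom A B).

Lemma asc_asc' h g f : asc h g f • asc' h g f = idm _.
Proof. unfold asc, asc'. now rewrite eqm_comp, eqm_idm. Qed.

Lemma asc'_asc h g f : asc' h g f • asc h g f = idm _.
Proof. unfold asc, asc'. now rewrite eqm_comp, eqm_idm. Qed.

Lemma lun_lun' f : lun f • lun' f = idm _.
Proof. unfold lun, lun'. now rewrite eqm_comp, eqm_idm. Qed.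

Lemma lun'_lun f : lun' f • lun f = idm _.
Proof. unfold lun, lun'. now rewrite eqm_comp, eqm_idm. Qed.

Lemma run_run' f : run f • run' f = idm _.
Proof. unfold run, run'. now rewrite eqm_comp, eqm_idm. Qed.

Lemma run'_run f : run' f • run f = idm _.
Proof. unfold run, run'. now rewrite eqm_comp, eqm_idm. Qed.

End StrictnessInverse.

(** * 2-cells up to the equality of their boundary *)

(** Pasting equations hold only after identity 2-cells [eqm] have been inserted
    between 1-cells that are equal but not convertible.  To make these invisible,
    a 2-cell [a] is replaced by the singleton class [pk a], which remembers its
    boundary only up to equality: [pk (eqm p • a) = pk a], and composition of
    classes is strictly associative and unital.  Classes are sets of 2-cells,
    rather than 2-cells with a boundary, so that composites are always defined,
    possibly empty; an equation between classes can then be used for rewriting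
    without any condition on boundaries. *)
Definition cells (K : category) := forall x y : K, x ⟹ y -> Prop.

Inductive pk {K : category} {x y : K} (a : x ⟹ y) : cells K :=
  pk_self : pk a a.

Lemma cells_ext {K : category} (S R : cells K) :
  (forall x y (a : x ⟹ y), S x y a <-> R x y a) -> S = R.
Proof.
  intros H.
  do 3 (apply functional_extensionality_dep; intro).
  apply propositional_extensionality, H.
Qed.

Lemma pk_dep {K : category} {x y x' y' : K} (a : x ⟹ y) (b : x' ⟹ y') :
  pk a b -> existT (fun z : K * K => fst z ⟹ snd z) (x, y) a
          = existT (fun z : K * K => fst z ⟹ snd z) (x', y') b.
Proof. now intros []. Qed.

Lemma pk_mem {K : category} {x y : K} (a b : x ⟹ y) : pk a b -> b = a.
Proof. intros H%pk_dep. symmetry. exact (inj_pairT2 _ _ _ _ _ H). Qed.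

(** Equations between parallel 2-cells may thus be proved on their classes. *)
Lemma pk_inj {K : category} {x y : K} (a b : x ⟹ y) : pk a = pk b -> a = b.
Proof. intros H. apply pk_mem. rewrite <- H. apply pk_self. Qed.

Definition vprod {K : category} (S R : cells K) : cells K := fun x z c =>
  exists y (b : y ⟹ z) (a : x ⟹ y), S y z b /\ R x y a /\ c = b • a.

Inductive hprod {X : two_category} {A B C : X}
    (S : cells (hom B C)) (R : cells (hom A B)) : cells (hom A C) :=
  hprod_mem g g' (b : g ⟹ g') f f' (a : f ⟹ f') :
    S g g' b -> R f f' a -> hprod S R (b ⋆ a).

Infix "·" := vprod (at level 55, right associativity).
Infix "⊗" := hprod (at level 44, right associativity).

Lemma vprod_assoc {K : category} (S R T : cells K) : (S · R) · T = S · R · T.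
Proof.
  apply cells_ext; intros x y a; split.
  - intros (z & b & c & (w & d & e & H1 & H2 & ->) & H3 & ->).
    exists w, d, (e • c). rewrite vcomp_assoc. firstorder.
  - intros (z & b & c & H1 & (w & d & e & H2 & H3 & ->) & ->).
    exists w, (b • d), e. rewrite vcomp_assoc. firstorder.
Qed.

Lemma pk_vcomp {K : category} {x y z : K} (b : y ⟹ z) (a : x ⟹ y) :
  pk (b • a) = pk b · pk a.
Proof.
  apply cells_ext; intros x' z' c; split.
  - intros []. exists y, b, a. firstorder using pk_self.
  - intros (w & b' & a' & Hb & Ha & ->). destruct Hb.
    assert (H : x = x') by now destruct Ha.
    destruct H. now rewrite (pk_mem Ha).
Qed.

Lemma pk_eqm_l {K : category} {x y z : K} (p : y = z) (a : x ⟹ y) :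
  pk (eqm p • a) = pk a.
Proof. destruct p; cbn. now rewrite vcomp_idl. Qed.

Lemma pk_eqm_r {K : category} {x y z : K} (p : x = y) (a : y ⟹ z) :
  pk (a • eqm p) = pk a.
Proof. destruct p; cbn. now rewrite vcomp_idr. Qed.

Lemma pk_eqm {K : category} {x y : K} (p : x = y) : pk (eqm p) = pk (idm x).
Proof. now destruct p. Qed.

Section Horizontal.
Context {X : two_category}.

Lemma pk_hcomp {A B C : X} {g g' : hom B C} {f f' : hom A B}
    (b : g ⟹ g') (a : f ⟹ f') : pk (b ⋆ a) = pk b ⊗ pk a.
Proof.
  apply cells_ext; intros x y c; split.
  - intros []. now constructor.
  - intros [? ? b' ? ? a' [] []]. constructor.
Qed.

Lemma pk_idm_comp {A B C : X} (g : hom B C) (f : hom A B) :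
  pk (idm (g ∘ f)) = pk (idm g) ⊗ pk (idm f).
Proof. now rewrite <- hcomp_id, pk_hcomp. Qed.

Lemma eqm_switch {K : category} {x y x' y' : K} (p : x = x') (q : y = y')
    (a : x ⟹ y) (b : x' ⟹ y') : eqm q • a = b • eqm p -> pk a = pk b.
Proof. intros H. now rewrite <- (pk_eqm_l q a), H, pk_eqm_r. Qed.

Lemma hprod_assoc {A B C D : X} (S : cells (hom C D)) (R : cells (hom B C))
    (T : cells (hom A B)) : (S ⊗ R) ⊗ T = S ⊗ R ⊗ T.
Proof.
  assert (E : forall (h h' : hom C D) (c : h ⟹ h') (g g' : hom B C) (b : g ⟹ g')
    (f f' : hom A B) (a : f ⟹ f'), pk (c ⋆ (b ⋆ a)) = pk ((c ⋆ b) ⋆ a)).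
  { intros. exact (eqm_switch (hcomp_assoc c b a)). }
  apply cells_ext; intros x y a; split.
  - intros [? ? cb ? ? a' [? ? c ? ? b Hc Hb] Ha].
    assert (M := pk_self ((c ⋆ b) ⋆ a')). rewrite <- E in M.
    destruct M. repeat constructor; assumption.
  - intros [? ? c ? ? ba Hc [? ? b ? ? a' Hb Ha]].
    assert (M := pk_self (c ⋆ (b ⋆ a'))). rewrite E in M.
    destruct M. repeat constructor; assumption.
Qed.

Lemma hprod_idl {A B : X} (S : cells (hom A B)) : pk (idm (id1 B)) ⊗ S = S.
Proof.
  assert (E : forall (f f' : hom A B) (a : f ⟹ f'), pk (idm (id1 B) ⋆ a) = pk a).
  { intros. exact (eqm_switch (hcomp_idl a)). }
  apply cells_ext; intros x y a; split.
  - intros [? ? b ? ? a' [] Ha].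
    assert (M := pk_self (idm (id1 B) ⋆ a')). rewrite E in M. now destruct M.
  - intros Ha. assert (M := pk_self a). rewrite <- E in M.
    destruct M. now constructor.
Qed.

Lemma hprod_idr {A B : X} (S : cells (hom A B)) : S ⊗ pk (idm (id1 A)) = S.
Proof.
  assert (E : forall (f f' : hom A B) (a : f ⟹ f'), pk (a ⋆ idm (id1 A)) = pk a).
  { intros. exact (eqm_switch (hcomp_idr a)). }
  apply cells_ext; intros x y a; split.
  - intros [? ? b ? ? a' Hb []].
    assert (M := pk_self (b ⋆ idm (id1 A))). rewrite E in M. now destruct M.
  - intros Ha. assert (M := pk_self a). rewrite <- E in M.
    destruct M. now constructor.
Qed.

End Horizontal.

(** * Pseudofunctors and whiskering *)

Section PseudofunctorLaws.
Context {X Y : two_category} {H0 : X -> Y} (H : pseudofunctor H0).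

Lemma pf_id {A B : X} (f : hom A B) : H @2 (idm f) = idm (H @1 f).
Proof. apply (on2_id (pf_laws H)). Qed.

Lemma pf_comp {A B : X} {f f' f'' : hom A B} (b : f' ⟹ f'') (a : f ⟹ f') :
  H @2 (b • a) = H @2 b • H @2 a.
Proof. apply (on2_comp (pf_laws H)). Qed.

Lemma pf_eqm {A B : X} {f f' : hom A B} (p : f = f') :
  H @2 (eqm p) = eqm (f_equal (on1 H) p).
Proof. destruct p. apply pf_id. Qed.

(** Moves an invertible 2-cell to the other side of a square; applied to the
    axioms of a pseudofunctor it gives their forms for [gam'] and [iot'], the
    direction in which these cells occur in pastings. *)
Lemma conj_inverse {K : category} {x y x' y' : K} {q : x ⟹ y} {p : y ⟹ x}
    {r : x' ⟹ y'} {r' : y' ⟹ x'} {s : x' ⟹ x} {t : y' ⟹ y} :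
  p • q = idm _ -> r • r' = idm _ -> q • s = t • r -> s • r' = p • t.
Proof.
  intros pq rr' E.
  rewrite <- (vcomp_idl s), <- pq, <- (vcomp_assoc p q s), E.
  now rewrite <- !vcomp_assoc, rr', vcomp_idr.
Qed.

Lemma gam'_nat {A B C : X} {g g' : hom B C} {f f' : hom A B}
    (b : g ⟹ g') (a : f ⟹ f') :
  H @2 (b ⋆ a) • gam' H g f = gam' H g' f' • ((H @2 b) ⋆ (H @2 a)).
Proof.
  destruct (pf_laws H) as [_ _ gK g'K _ _ nat _ _ _].
  exact (conj_inverse (gK _ _ _ _ _) (g'K _ _ _ _ _) (nat _ _ _ _ _ _ _ b a)).
Qed.

Lemma gam'_assoc {A B C D : X} (h : hom C D) (g : hom B C) (f : hom A B) :
  H @2 (asc h g f) • gam' H h (g ∘ f) • ((H @1 h) ◁ gam' H g f)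
  = gam' H (h ∘ g) f • (gam' H h g ▷ (H @1 f)) • asc _ _ _.
Proof.
  destruct (pf_laws H) as [_ _ gK g'K _ _ _ ass _ _].
  rewrite (vcomp_assoc (gam' _ _ _)).
  refine (conj_inverse (q := (gam H h g ▷ (H @1 f)) • gam H (h ∘ g) f)
            (r := ((H @1 h) ◁ gam H g f) • gam H h (g ∘ f)) _ _ _).
  - rewrite <- vcomp_assoc, (vcomp_assoc (gam' H h g ▷ _)), <- whr_comp, gK.
    now rewrite hcomp_id, vcomp_idl, gK.
  - rewrite <- vcomp_assoc, (vcomp_assoc (gam H h _)), g'K, vcomp_idl.
    now rewrite <- whl_comp, g'K, hcomp_id.
  - now rewrite <- vcomp_assoc.
Qed.

Lemma gam'_idl {A B : X} (f : hom A B) :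
  H @2 (lun f) • gam' H (id1 B) f • (iot' H B ▷ (H @1 f)) = lun _.
Proof.
  destruct (pf_laws H) as [_ _ gK g'K iK i'K _ _ idl _].
  rewrite <- idl, <- !vcomp_assoc, (vcomp_assoc (gam H _ _)), g'K, vcomp_idl.
  now rewrite <- whr_comp, i'K, hcomp_id, vcomp_idr.
Qed.

Lemma gam'_idr {A B : X} (f : hom A B) :
  H @2 (run f) • gam' H f (id1 A) • ((H @1 f) ◁ iot' H A) = run _.
Proof.
  destruct (pf_laws H) as [_ _ gK g'K iK i'K _ _ _ idr].
  rewrite <- idr, <- !vcomp_assoc, (vcomp_assoc (gam H _ _)), g'K, vcomp_idl.
  now rewrite <- whl_comp, i'K, hcomp_id, vcomp_idr.
Qed.

End PseudofunctorLaws.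

(** * A tactic for pasting equations *)

(** Variants of an equation for rewriting at the head of a longer right-nested
    product. *)
Section Under.
Context {K : category}.
Implicit Types S R T : cells K.

Lemma vprod_under1 {S R} : S = R -> forall T, S · T = R · T.
Proof. now intros ->. Qed.

Lemma vprod_under2 {S1 S2 R} :
  S1 · S2 = R -> forall T, S1 · S2 · T = R · T.
Proof. intros <- T. now rewrite vprod_assoc. Qed.

Lemma vprod_under3 {S1 S2 S3 R} :
  S1 · S2 · S3 = R -> forall T, S1 · S2 · S3 · T = R · T.
Proof. intros <- T. now rewrite !vprod_assoc. Qed.

Lemma vprod_under4 {S1 S2 S3 S4 R} :
  S1 · S2 · S3 · S4 = R -> forall T, S1 · S2 · S3 · S4 · T = R · T.
Proof. intros <- T. now rewrite !vprod_assoc. Qed.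

End Under.

(** [pack] reduces an equation of 2-cells to one between products of layers: each
    layer is a single generating 2-cell whiskered by 1-cells, the whiskers are
    split into their factors, and every [eqm] has disappeared.  [prw H] brings the
    equation [H] of 2-cells to the same form and rewrites with it. *)
Ltac expand_hcomp :=
  match goal with
  | |- context [@hcomp ?X ?A ?B ?C ?g ?g' ?f ?f' ?b ?a] =>
      lazymatch b with idm _ => fail | _ => idtac end;
      lazymatch a with idm _ => fail | _ => idtac end;
      rewrite (@hcomp_lr X A B C g g' f f' b a)
  end.
Ltac typed_nf := unfold asc, asc', lun, lun', run, run';
  repeat first [ rewrite pf_id | rewrite hcomp_id | rewrite vcomp_idl
               | rewrite vcomp_idr | rewrite whl_comp | rewrite whr_comp
               | rewrite eqm_whl | rewrite eqm_whr | rewrite pf_comp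
               | rewrite pf_eqm | rewrite eqm_comp | rewrite eqm_comp_l
               | rewrite <- vcomp_assoc | expand_hcomp ].
Ltac pk_nf :=
  repeat first [ rewrite pk_eqm_l | rewrite pk_eqm_r | rewrite pk_eqm
               | rewrite vcomp_idl | rewrite vcomp_idr | rewrite pk_vcomp ];
  repeat first [ rewrite pk_hcomp | rewrite pk_idm_comp ];
  repeat first [ rewrite hprod_assoc | rewrite hprod_idl | rewrite hprod_idr
               | rewrite vprod_assoc ].
Ltac pack := apply pk_inj; typed_nf; pk_nf.
Ltac prw H :=
  let E := fresh "E" in
  pose proof (f_equal pk H) as E; cbv beta in E;
  lazymatch goal with |- ?G =>
    let G' := fresh "G" in
    set (G' := G); revert E; typed_nf; pk_nf; intros E; unfold G'; clear G'
  end;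
  first [ rewrite (vprod_under4 E) | rewrite (vprod_under3 E)
        | rewrite (vprod_under2 E) | rewrite (vprod_under1 E) | rewrite E ];
  rewrite ?vprod_assoc; clear E.

(** * The calculus of 2-cells h ⟹ Uk y *)

Section Actions.
Context {D C : two_category} {U0 : D -> C} {U : pseudofunctor U0}
  {F0 : C -> D} {y : forall A : C, hom A (U0 (F0 A))}.

(** A 2-cell [σ : h ⟹ Uk y_A] is treated as an arrow from [h] to [k] across [U].
    The 2-cells of [D] act on it by [push], its 1-cells by [act], and two such
    cells compose by [paste_ext], with [unit_cell] as a unit.  The coherence
    axioms of [U] enter the proof only through the laws below, which say that
    these operations are functorial, associative and unital. *)
Definition push {A : C} {Z : D} {h : hom A (U0 Z)} {k l : hom (F0 A) Z}
    (θ : k ⟹ l) (σ : h ⟹ (U @1 k) ∘ y A) : h ⟹ (U @1 l) ∘ y A :=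
  (U @2 θ ▷ y A) • σ.

Definition act {A : C} {Z W : D} (m : hom Z W) {h : hom A (U0 Z)}
    {k : hom (F0 A) Z} (σ : h ⟹ (U @1 k) ∘ y A) :
    (U @1 m) ∘ h ⟹ (U @1 (m ∘ k)) ∘ y A :=
  (gam' U m k ▷ y A) • asc _ _ _ • ((U @1 m) ◁ σ).

Definition unit_cell (A : C) : y A ⟹ (U @1 (id1 (F0 A))) ∘ y A :=
  (iot' U (F0 A) ▷ y A) • lun' (y A).

Infix "⊙" := push (at level 53, right associativity).

Lemma push_id {A : C} {Z : D} {h : hom A (U0 Z)} {k : hom (F0 A) Z}
    (σ : h ⟹ (U @1 k) ∘ y A) : idm k ⊙ σ = σ.
Proof. unfold push. now rewrite pf_id, hcomp_id, vcomp_idl. Qed.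

Lemma push_comp {A : C} {Z : D} {h : hom A (U0 Z)} {k l m : hom (F0 A) Z}
    (κ : l ⟹ m) (θ : k ⟹ l) (σ : h ⟹ (U @1 k) ∘ y A) :
  (κ • θ) ⊙ σ = κ ⊙ θ ⊙ σ.
Proof. unfold push. now rewrite pf_comp, whr_comp, <- vcomp_assoc. Qed.

Lemma push_pre {A : C} {Z : D} {h h' : hom A (U0 Z)} {k l : hom (F0 A) Z}
    (θ : k ⟹ l) (σ : h ⟹ (U @1 k) ∘ y A) (β : h' ⟹ h) :
  (θ ⊙ σ) • β = θ ⊙ (σ • β).
Proof. symmetry; apply vcomp_assoc. Qed.

Lemma act_nat {A : C} {Z W : D} {m m' : hom Z W} {h : hom A (U0 Z)}
    {k l : hom (F0 A) Z} (θ : m ⟹ m') (κ : k ⟹ l)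
    (σ : h ⟹ (U @1 k) ∘ y A) :
  (θ ⋆ κ) ⊙ act m σ = act m' (κ ⊙ σ) • (U @2 θ ▷ h).
Proof.
  unfold push, act. pack.
  prw (f_equal (fun z => z ▷ y A) (gam'_nat U (idm m) κ)).
  prw (f_equal (fun z => z ▷ y A) (gam'_nat U θ (idm l))).
  prw (slide (U @2 θ) ((U @2 κ ▷ y A) • σ)).
  reflexivity.
Qed.

Lemma act_pre {A : C} {Z W : D} (m : hom Z W) {h h' : hom A (U0 Z)}
    {k : hom (F0 A) Z} (σ : h ⟹ (U @1 k) ∘ y A) (β : h' ⟹ h) :
  act m (σ • β) = act m σ • ((U @1 m) ◁ β).
Proof. unfold act. now rewrite whl_comp, !vcomp_assoc. Qed.

(** The coherence of [U] with respect to composition, in the form with [gam'];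
    [act_comp] is its rearrangement for use from left to right. *)
Lemma act_comp_gam' {A : C} {Z W V : D} (n : hom W V) (m : hom Z W)
    {h : hom A (U0 Z)} {k : hom (F0 A) Z} (σ : h ⟹ (U @1 k) ∘ y A) :
  act (n ∘ m) σ • (gam' U n m ▷ h) • asc _ _ _
  = asc n m k ⊙ act n (act m σ).
Proof.
  unfold push, act. pack.
  prw (f_equal (fun z => z ▷ y A) (gam'_assoc U n m k)).
  prw (eq_sym (slide (gam' U n m) σ)).
  reflexivity.
Qed.

Lemma act_comp {A : C} {Z W V : D} (n : hom W V) (m : hom Z W)
    {h : hom A (U0 Z)} {k : hom (F0 A) Z} (σ : h ⟹ (U @1 k) ∘ y A) :
  act (n ∘ m) σ = asc n m k ⊙ act n (act m σ) • asc' _ _ _ • (gam U n m ▷ h).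
Proof.
  rewrite <- act_comp_gam', <- !vcomp_assoc, (vcomp_assoc (asc _ _ _)).
  rewrite asc_asc', vcomp_idl, <- whr_comp, (gamK (pf_laws U)), hcomp_id.
  now rewrite vcomp_idr.
Qed.

Lemma act_id {A : C} {Z : D} {h : hom A (U0 Z)} {k : hom (F0 A) Z}
    (σ : h ⟹ (U @1 k) ∘ y A) :
  lun k ⊙ act (id1 Z) σ = σ • lun h • (iot U Z ▷ h).
Proof.
  assert (E : lun k ⊙ act (id1 Z) σ • (iot' U Z ▷ h) • lun' h = σ).
  { unfold push, act. pack.
    prw (eq_sym (slide (iot' U Z) σ)).
    prw (f_equal (fun z => z ▷ y A) (gam'_idl U k)).
    now rewrite <- pk_idm_comp, <- pk_vcomp, vcomp_idl. }
  rewrite <- E at 2.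
  rewrite <- !vcomp_assoc, (vcomp_assoc (lun' _)).
  rewrite lun'_lun, vcomp_idl, <- whr_comp, (iotK (pf_laws U)), hcomp_id.
  now rewrite vcomp_idr.
Qed.

Lemma act_unit {A : C} {Z : D} (k : hom (F0 A) Z) :
  run k ⊙ act k (unit_cell A) = idm _.
Proof.
  unfold unit_cell, push, act. pack.
  prw (f_equal (fun z => z ▷ y A) (gam'_idr U k)).
  now rewrite <- pk_idm_comp.
Qed.

Lemma act_unit' {A : C} {Z : D} (k : hom (F0 A) Z) :
  act k (unit_cell A) = run' k ⊙ idm _.
Proof. now rewrite <- (act_unit k), <- push_comp, run'_run, push_id. Qed.

(** Pasting is an action after a whiskering, so that the laws of [paste_ext]
    follow from those of [act] and from the interchange law. *)
Lemma paste_extE {A B : C} {Z : D} {f : hom A B} {h : hom B (U0 Z)}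
    {k : hom (F0 B) Z} {l : hom (F0 A) (F0 B)}
    (σ : h ⟹ (U @1 k) ∘ y B) (τ : y B ∘ f ⟹ (U @1 l) ∘ y A) :
  paste_ext σ τ = act k τ • asc' _ _ _ • (σ ▷ f).
Proof. unfold paste_ext, act. now rewrite <- !vcomp_assoc. Qed.

Lemma paste_push {A B : C} {Z : D} {f : hom A B} {h : hom B (U0 Z)}
    {k k' : hom (F0 B) Z} {l l' : hom (F0 A) (F0 B)} (κ : k ⟹ k') (θ : l ⟹ l')
    (σ : h ⟹ (U @1 k) ∘ y B) (τ : y B ∘ f ⟹ (U @1 l) ∘ y A) :
  (κ ⋆ θ) ⊙ paste_ext σ τ = paste_ext (κ ⊙ σ) (θ ⊙ τ).
Proof.
  rewrite !paste_extE, <- push_pre, act_nat. unfold push. pack.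
  reflexivity.
Qed.

Lemma paste_pre {A B : C} {Z : D} {f f' : hom A B} {h h' : hom B (U0 Z)}
    {k : hom (F0 B) Z} {l : hom (F0 A) (F0 B)}
    (σ : h ⟹ (U @1 k) ∘ y B) (τ : y B ∘ f ⟹ (U @1 l) ∘ y A)
    (β : h' ⟹ h) (a : f' ⟹ f) :
  paste_ext (σ • β) (τ • (y B ◁ a)) = paste_ext σ τ • (β ⋆ a).
Proof.
  rewrite !paste_extE, act_pre. pack.
  prw (slide β a). prw (slide σ a). reflexivity.
Qed.

Lemma paste_act {A B : C} {Z W : D} (m : hom Z W) {f : hom A B}
    {h : hom B (U0 Z)} {k : hom (F0 B) Z} {l : hom (F0 A) (F0 B)}
    (σ : h ⟹ (U @1 k) ∘ y B) (τ : y B ∘ f ⟹ (U @1 l) ∘ y A) :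
  paste_ext (act m σ) τ • asc _ _ _ = asc m k l ⊙ act m (paste_ext σ τ).
Proof.
  rewrite !paste_extE, !act_pre, <- !push_pre, <- act_comp_gam'.
  unfold act at 2. pack. reflexivity.
Qed.

Lemma paste_assoc {A B B' : C} {Z : D} {f : hom B B'} {e : hom A B}
    {h : hom B' (U0 Z)} {k : hom (F0 B') Z} {l : hom (F0 B) (F0 B')}
    {m : hom (F0 A) (F0 B)} (σ : h ⟹ (U @1 k) ∘ y B')
    (τ : y B' ∘ f ⟹ (U @1 l) ∘ y B) (ρ : y B ∘ e ⟹ (U @1 m) ∘ y A) :
  paste_ext (paste_ext σ τ) ρ • asc h f e
  = asc k l m ⊙ paste_ext σ (paste_ext τ ρ • asc (y B') f e).
Proof.
  rewrite (paste_extE σ (_ • _)), act_pre.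
  pose proof (paste_act k τ ρ) as E.
  transitivity (paste_ext (act k τ) ρ • asc _ _ _ • (_ ◁ asc _ f e) • asc' _ _ _
    • (σ ▷ (f ∘ e))).
  - rewrite !paste_extE. pack. reflexivity.
  - rewrite (vcomp_assoc (paste_ext _ _)), E. unfold push. pack. reflexivity.
Qed.

Lemma paste_unit_l {A B : C} {f : hom A B} {l : hom (F0 A) (F0 B)}
    (τ : y B ∘ f ⟹ (U @1 l) ∘ y A) : lun l ⊙ paste_ext (unit_cell B) τ = τ.
Proof.
  rewrite paste_extE, <- push_pre, act_id. unfold unit_cell. pack.
  prw (f_equal (fun z => z ▷ (y B ∘ f)) (iot'K (pf_laws U) (F0 B))).
  now rewrite <- pk_idm_comp, <- pk_vcomp, vcomp_idr.
Qed.

Lemma paste_unit_r {B : C} {Z : D} {h : hom B (U0 Z)} {k : hom (F0 B) Z}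
    (σ : h ⟹ (U @1 k) ∘ y B) :
  run k ⊙ paste_ext σ (unit_cell B • run (y B)) = σ • run h.
Proof.
  rewrite paste_extE, act_pre, <- !push_pre, act_unit, vcomp_idl. pack.
  reflexivity.
Qed.

Lemma act_nat_l {A : C} {Z W : D} {m m' : hom Z W} {h : hom A (U0 Z)}
    {k : hom (F0 A) Z} (θ : m ⟹ m') (σ : h ⟹ (U @1 k) ∘ y A) :
  (θ ▷ k) ⊙ act m σ = act m' σ • (U @2 θ ▷ h).
Proof. now rewrite act_nat, push_id. Qed.

Lemma act_nat_r {A : C} {Z W : D} (m : hom Z W) {h : hom A (U0 Z)}
    {k l : hom (F0 A) Z} (κ : k ⟹ l) (σ : h ⟹ (U @1 k) ∘ y A) :
  (m ◁ κ) ⊙ act m σ = act m (κ ⊙ σ).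
Proof. now rewrite act_nat, pf_id, hcomp_id, vcomp_idr. Qed.

Section PasteOneSided.
Context {A B : C} {Z : D} {f : hom A B} {h : hom B (U0 Z)}
  {k : hom (F0 B) Z} {l : hom (F0 A) (F0 B)}
  (σ : h ⟹ (U @1 k) ∘ y B) (τ : y B ∘ f ⟹ (U @1 l) ∘ y A).

Lemma paste_push_l {k' : hom (F0 B) Z} (κ : k ⟹ k') :
  (κ ▷ l) ⊙ paste_ext σ τ = paste_ext (κ ⊙ σ) τ.
Proof. now rewrite paste_push, push_id. Qed.

Lemma paste_push_r {l' : hom (F0 A) (F0 B)} (θ : l ⟹ l') :
  (k ◁ θ) ⊙ paste_ext σ τ = paste_ext σ (θ ⊙ τ).
Proof. now rewrite paste_push, push_id. Qed.

Lemma paste_pre_l {h' : hom B (U0 Z)} (β : h' ⟹ h) :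
  paste_ext (σ • β) τ = paste_ext σ τ • (β ▷ f).
Proof. now rewrite <- paste_pre, hcomp_id, vcomp_idr. Qed.

Lemma paste_pre_r {f' : hom A B} (a : f' ⟹ f) :
  paste_ext σ (τ • (y B ◁ a)) = paste_ext σ τ • (h ◁ a).
Proof. now rewrite <- paste_pre, vcomp_idr. Qed.

End PasteOneSided.

End Actions.

Infix "⊙" := push (at level 53, right associativity).

(** * Invertible 2-cells *)

Definition invertible {K : category} {x y : K} (a : x ⟹ y) : Prop :=
  exists b : y ⟹ x, b • a = idm x /\ a • b = idm y.

Lemma invertible_eqm {K : category} {x y : K} (p : x = y) : invertible (eqm p).
Proof. exists (eqm (eq_sym p)). now rewrite !eqm_comp, !eqm_idm. Qed.

Lemma invertible_comp {K : category} {x y z : K} {b : y ⟹ z} {a : x ⟹ y} :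
  invertible b -> invertible a -> invertible (b • a).
Proof.
  intros [b' [Eb Eb']] [a' [Ea Ea']]. exists (a' • b'). split.
  - now rewrite <- vcomp_assoc, (vcomp_assoc b'), Eb, vcomp_idl.
  - now rewrite <- vcomp_assoc, (vcomp_assoc a), Ea', vcomp_idl.
Qed.

Lemma invertible_hcomp {X : two_category} {A B C : X} {g g' : hom B C}
    {f f' : hom A B} {b : g ⟹ g'} {a : f ⟹ f'} :
  invertible b -> invertible a -> invertible (b ⋆ a).
Proof.
  intros [b' [Eb Eb']] [a' [Ea Ea']]. exists (b' ⋆ a').
  now rewrite <- !interchange, Eb, Eb', Ea, Ea', !hcomp_id.
Qed.

Lemma invertible_idm {K : category} (x : K) : invertible (idm x).
Proof. exact (invertible_eqm eq_refl). Qed.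

Lemma invertible_gam {X Y : two_category} {H0 : X -> Y} (H : pseudofunctor H0)
    {A B C : X} (g : hom B C) (f : hom A B) : invertible (gam H g f).
Proof. exists (gam' H g f). split; [apply gamK | apply gam'K]; apply pf_laws. Qed.

Lemma invertible_iot {X Y : two_category} {H0 : X -> Y} (H : pseudofunctor H0)
    (A : X) : invertible (iot H A).
Proof. exists (iot' H A). split; [apply iotK | apply iot'K]; apply pf_laws. Qed.

Lemma invertible_on2 {X Y : two_category} {H0 : X -> Y} (H : pseudofunctor H0)
    {A B : X} {f g : hom A B} {a : f ⟹ g} : invertible a -> invertible (H @2 a).
Proof.
  intros [b [E E']]. exists (H @2 b).
  now rewrite <- !pf_comp, E, E', !pf_id.
Qed.

(** * U-extensions *)

Section Extensions.
Context {D C : two_category} {U0 : D -> C} {U : pseudofunctor U0}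
  {F0 : C -> D} {y : forall A : C, hom A (U0 (F0 A))}.

Section Universal.
Context {A : C} {Z : D} {f : hom A (U0 Z)} {k : hom (F0 A) Z}
  {ψ : f ⟹ (U @1 k) ∘ y A} (H : is_U_extension ψ).

Lemma extension_cancel {g : hom (F0 A) Z} (θ θ' : k ⟹ g) :
  θ ⊙ ψ = θ' ⊙ ψ -> θ = θ'.
Proof.
  intros E. destruct (H (θ' ⊙ ψ)) as [κ [_ Hκ]].
  transitivity κ; [symmetry|]; apply Hκ; [exact E | reflexivity].
Qed.

Lemma lift_exists {g : hom (F0 A) Z} (α : f ⟹ (U @1 g) ∘ y A) :
  exists θ : k ⟹ g, θ ⊙ ψ = α.
Proof. destruct (H α) as [θ [E _]]. now exists θ. Qed.

Definition lift {g : hom (F0 A) Z} (α : f ⟹ (U @1 g) ∘ y A) : k ⟹ g :=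
  proj1_sig (constructive_indefinite_description _ (lift_exists α)).

Lemma lift_push {g : hom (F0 A) Z} (α : f ⟹ (U @1 g) ∘ y A) : lift α ⊙ ψ = α.
Proof. unfold lift. apply proj2_sig. Qed.

End Universal.

Lemma lift_inverse {A : C} {Z : D} {f : hom A (U0 Z)} {k l : hom (F0 A) Z}
    {ψ : f ⟹ (U @1 k) ∘ y A} {χ : f ⟹ (U @1 l) ∘ y A}
    (H : is_U_extension ψ) (θ : k ⟹ l) (κ : l ⟹ k) :
  θ ⊙ ψ = χ -> κ ⊙ χ = ψ -> κ • θ = idm k.
Proof.
  intros E E'. apply (extension_cancel H).
  now rewrite push_comp, E, E', push_id.
Qed.

(** Extensions are invariant under isomorphism.  The closure conditions on a choice
    of extensions follow from an adjunction through this fact: each composite in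
    question is isomorphic to an extension. *)
Lemma extension_iso {A : C} {Z : D} {f : hom A (U0 Z)} {k l : hom (F0 A) Z}
    {ψ : f ⟹ (U @1 k) ∘ y A} {χ : f ⟹ (U @1 l) ∘ y A} (i : k ⟹ l) :
  invertible i -> i ⊙ ψ = χ -> is_U_extension ψ -> is_U_extension χ.
Proof.
  intros [j [ji ij]] <- H g α. exists (lift H α • j). split.
  - change ((lift H α • j) ⊙ i ⊙ ψ = α).
    now rewrite <- push_comp, <- vcomp_assoc, ji, vcomp_idr, lift_push.
  - intros θ Eθ. rewrite <- (vcomp_idr θ), <- ij, vcomp_assoc. f_equal.
    apply (extension_cancel H). rewrite lift_push, push_comp.
    symmetry. exact Eθ.
Qed.

Lemma extension_iso_inv {A : C} {Z : D} {f : hom A (U0 Z)}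
    {k l : hom (F0 A) Z} {ψ : f ⟹ (U @1 k) ∘ y A} {χ : f ⟹ (U @1 l) ∘ y A}
    (i : k ⟹ l) :
  invertible i -> i ⊙ ψ = χ -> is_U_extension χ -> is_U_extension ψ.
Proof.
  intros [j [ji ij]] <-. apply (extension_iso (i := j)).
  - now exists i.
  - now rewrite <- push_comp, ji, push_id.
Qed.

End Extensions.

(** * Mates of 1-cells into the image of U *)

Unset Implicit Arguments.

(** Both directions of the equivalence use a pseudofunctor [F] with 2-cells [eta]
    of a unit and [Phi] of a modification.  Only the laws relating these to [push]
    are assumed, since in one direction the counit is not available yet. *)
Section Mates.
Context {D C : two_category} {U0 : D -> C} {U : pseudofunctor U0}
  {F0 : C -> D} {y : forall A : C, hom A (U0 (F0 A))} {F : pseudofunctor F0}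
  {eta : forall (A B : C) (f : hom A B), y B ∘ f ⟹ (U @1 (F @1 f)) ∘ y A}
  {eps : forall Z : D, hom (F0 (U0 Z)) Z}
  {Phi : forall Z : D, id1 (U0 Z) ⟹ (U @1 (eps Z)) ∘ y (U0 Z)}.

(** The candidate for exhibiting [eps Z ∘ F f] as an extension of [f]: the unit of
    the local adjunction between [f |-> eps Z ∘ F f] and [g |-> Ug ∘ y_A] on hom-categories. *)
Definition mate {A : C} {Z : D} (f : hom A (U0 Z)) :
    f ⟹ (U @1 (eps Z ∘ F @1 f)) ∘ y A :=
  paste_ext (Phi Z) (eta A (U0 Z) f) • lun' f.

Lemma push_mate
    (push_F2 : forall (A B : C) (f f' : hom A B) (a : f ⟹ f'),
      F @2 a ⊙ eta A B f = eta A B f' • (y B ◁ a))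
    {A : C} {Z : D} {f f' : hom A (U0 Z)} (a : f ⟹ f') :
  (eps Z ◁ F @2 a) ⊙ mate f = mate f' • a.
Proof.
  unfold mate. rewrite <- push_pre, paste_push_r, push_F2, paste_pre_r.
  pack. reflexivity.
Qed.

Context (push_gam : forall (A B E : C) (g : hom B E) (f : hom A B),
  gam F g f ⊙ eta A E (g ∘ f)
  = paste_ext (eta B E g) (eta A B f) • asc (y E) g f).

Lemma mate_comp {A B : C} {Z : D} (g : hom B (U0 Z)) (f : hom A B) :
  asc _ _ _ ⊙ (eps Z ◁ gam F g f) ⊙ mate (g ∘ f)
  = paste_ext (mate g) (eta A B f).
Proof.
  unfold mate. rewrite <- push_pre, paste_push_r, push_gam.
  rewrite <- push_pre, <- paste_assoc, paste_pre_l.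
  pack. reflexivity.
Qed.

(** The counit at [k] carries the mate of [Uk ∘ f] to the mate of [f] acted on by
    [k].  This is what removes [eps2] from the second swallowtail identity,
    from the modification axiom of the other triangle, and from transposes. *)
Lemma mate_counit
    {eps2 : forall (X Z : D) (f : hom X Z), eps Z ∘ F @1 (U @1 f) ⟹ f ∘ eps X}
    (push_eps2 : forall (X Z : D) (f : hom X Z),
      eps2 X Z f ⊙ mate (U @1 f) = act f (Phi X) • run' (U @1 f))
    {A : C} {X Z : D} (k : hom X Z) (f : hom A (U0 X)) :
  (eps2 X Z k ▷ F @1 f) ⊙ asc _ _ _ ⊙ (eps Z ◁ gam F (U @1 k) f)
    ⊙ mate (U @1 k ∘ f) = asc _ _ _ ⊙ act k (mate f).
Proof.
  rewrite mate_comp, paste_push_l, push_eps2, paste_pre_l. unfold mate.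
  rewrite act_pre, <- push_pre, <- paste_act. pack. reflexivity.
Qed.

End Mates.

(** * From U-extensions to a colax adjunction *)

Module FromExtensions.

Section FromExtensions.
Context {D C : two_category} {U0 : D -> C} {U : pseudofunctor U0}
  {F0 : C -> D} {y : forall A : C, hom A (U0 (F0 A))}
  {d : chosen_U_extensions U y} (Hcoh : coherent_choice d)
  (Hunit : unit_axiom U y) (Hcomp : composition_axiom d).

Definition Fon1 {A B : C} (f : hom A B) : hom (F0 A) (F0 B) := ext d (y B ∘ f).
Definition eta {A B : C} (f : hom A B) : y B ∘ f ⟹ (U @1 (Fon1 f)) ∘ y A :=
  ext_cell d (y B ∘ f).

Lemma eta_ext {A B : C} (f : hom A B) : is_U_extension (eta f).
Proof. apply ext_universal. Qed.

Lemma unit_ext (A : C) : is_U_extension (unit_cell (U := U) (y := y) A).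
Proof. apply Hunit. Qed.

Lemma eta_comp_ext {A B Z : C} (g : hom B Z) (f : hom A B) :
  is_U_extension (paste_ext (eta g) (eta f)).
Proof. apply Hcomp. Qed.

(** Every structure cell is the 2-cell induced by the universal property from the
    composite that it must be pushed to.  That [gam] and [iot] are invertible is
    the content of the composition and unit axioms: their targets are extensions
    too. *)
Definition F_data : pseudo_data F0 := {|
  on1 := @Fon1;
  on2 := fun A B f f' a => lift (eta_ext f) (eta f' • (y B ◁ a));
  gam := fun A B Z g f =>
    lift (eta_ext (g ∘ f)) (paste_ext (eta g) (eta f) • asc (y Z) g f);
  gam' := fun A B Z g f =>
    lift (eta_comp_ext g f) (eta (g ∘ f) • asc' (y Z) g f);
  iot := fun A => lift (eta_ext (id1 A)) (unit_cell A • run (y A));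
  iot' := fun A => lift (unit_ext A) (eta (id1 A) • run' (y A))
|}.

Lemma push_F2 {A B : C} {f f' : hom A B} (a : f ⟹ f') :
  F_data @2 a ⊙ eta f = eta f' • (y B ◁ a).
Proof. apply (lift_push (eta_ext f)). Qed.

Lemma push_gam {A B Z : C} (g : hom B Z) (f : hom A B) :
  gam F_data g f ⊙ eta (g ∘ f) = paste_ext (eta g) (eta f) • asc (y Z) g f.
Proof. apply (lift_push (eta_ext (g ∘ f))). Qed.

Lemma push_gam' {A B Z : C} (g : hom B Z) (f : hom A B) :
  gam' F_data g f ⊙ paste_ext (eta g) (eta f) = eta (g ∘ f) • asc' (y Z) g f.
Proof. apply (lift_push (eta_comp_ext g f)). Qed.

Lemma push_iot (A : C) :
  iot F_data A ⊙ eta (id1 A) = unit_cell A • run (y A).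
Proof. apply (lift_push (eta_ext (id1 A))). Qed.

Lemma push_iot' (A : C) :
  iot' F_data A ⊙ unit_cell A = eta (id1 A) • run' (y A).
Proof. apply (lift_push (unit_ext A)). Qed.

(** Each law is an equation between 2-cells out of an extension, so it is enough to
    push both sides along it; the laws of pasting do the rest. *)
Lemma F_laws : is_pseudofunctor F_data.
Proof.
  constructor; intros.
  - apply (extension_cancel (eta_ext f)).
    now rewrite push_F2, push_id, hcomp_id, vcomp_idr.
  - apply (extension_cancel (eta_ext f)).
    rewrite push_comp, !push_F2, <- push_pre, push_F2.
    now rewrite whl_comp, vcomp_assoc.
  - apply (extension_cancel (eta_ext (g ∘ f))).
    rewrite push_comp, push_gam, <- push_pre, push_gam', push_id.
    now rewrite <- vcomp_assoc, asc'_asc, vcomp_idr.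
  - apply (extension_cancel (eta_comp_ext g f)).
    rewrite push_comp, push_gam', <- push_pre, push_gam, push_id.
    now rewrite <- vcomp_assoc, asc_asc', vcomp_idr.
  - apply (extension_cancel (eta_ext (id1 A))).
    rewrite push_comp, push_iot, <- push_pre, push_iot', push_id.
    now rewrite <- vcomp_assoc, run'_run, vcomp_idr.
  - apply (extension_cancel (unit_ext A)).
    rewrite push_comp, push_iot', <- push_pre, push_iot, push_id.
    now rewrite <- vcomp_assoc, run_run', vcomp_idr.
  - apply (extension_cancel (eta_ext (g ∘ f))).
    rewrite !push_comp, push_F2, <- push_pre, !push_gam.
    rewrite <- push_pre, paste_push, !push_F2, paste_pre. pack. reflexivity.
  - apply (extension_cancel (eta_ext (h ∘ (g ∘ f)))).
    rewrite !push_comp, push_F2, push_gam, <- !push_pre, push_gam.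
    rewrite <- !push_pre, paste_push_l, push_gam, paste_pre_l.
    rewrite paste_push_r, push_gam, <- paste_assoc.
    pack. reflexivity.
  - apply (extension_cancel (eta_ext (id1 B ∘ f))).
    rewrite !push_comp, push_F2, push_gam, <- !push_pre.
    rewrite paste_push_l, push_iot, paste_pre_l.
    rewrite <- push_pre, paste_unit_l. pack. reflexivity.
  - apply (extension_cancel (eta_ext (f ∘ id1 A))).
    rewrite !push_comp, push_F2, push_gam, <- !push_pre.
    rewrite paste_push_r, push_iot, paste_unit_r. pack. reflexivity.
Qed.

Definition F : pseudofunctor F0 := Pseudofunctor F_laws.

Lemma push_on2 {A B : C} {f f' : hom A B} (a : f ⟹ f') :
  F @2 a ⊙ eta f = eta f' • (y B ◁ a).
Proof. apply push_F2. Qed.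

Lemma push_gamF {A B Z : C} (g : hom B Z) (f : hom A B) :
  gam F g f ⊙ eta (g ∘ f) = paste_ext (eta g) (eta f) • asc (y Z) g f.
Proof. apply push_gam. Qed.

Definition eta_data : colax_data (@on1 _ _ _ (id_pf C))
    (@on1 _ _ _ (comp_pf U F)) := {|
  cell1 := y;
  cell2 := fun A B f => eta f : y B ∘ (id_pf C @1 f) ⟹ (comp_pf U F @1 f) ∘ y A
|}.

Lemma eta_laws : is_colax (H := id_pf C) (G := comp_pf U F) eta_data.
Proof.
  constructor; cbn; intros.
  - symmetry. apply push_F2.
  - pose proof (push_iot A) as E. unfold push in E. cbn in E.
    rewrite whr_comp, <- vcomp_assoc.
    rewrite E. unfold unit_cell. pack.
    prw (f_equal (fun z => z ▷ y A) (iot'K (pf_laws U) (F0 A))).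
    reflexivity.
  - pose proof (push_gam g f) as E. unfold push in E. cbn in E.
    rewrite whr_comp, <- vcomp_assoc, E. unfold paste_ext.
    rewrite hcomp_id, vcomp_idr, !vcomp_assoc, <- whr_comp.
    now rewrite (gam'K (pf_laws U)), hcomp_id, vcomp_idl.
Qed.

Definition counit1 (Z : D) : hom (F0 (U0 Z)) Z := ext d (id1 (U0 Z)).
Definition Phi (Z : D) : id1 (U0 Z) ⟹ (U @1 (counit1 Z)) ∘ y (U0 Z) :=
  ext_cell d (id1 (U0 Z)).

Local Notation mate :=
  (mate (F := F) (eta := @eta) (eps := counit1) (Phi := Phi)).

Lemma Phi_ext (Z : D) : is_U_extension (Phi Z).
Proof. apply ext_universal. Qed.

(** This is coherent closure: it provides the universal property needed for 2-cells
    out of composites [eps ∘ F f], hence for the counit. *)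
Lemma mate_ext {A : C} {Z : D} (f : hom A (U0 Z)) : is_U_extension (mate f).
Proof. apply Hcoh. Qed.

(** The equation that defines [counit2] is the modification axiom of [Phi]. *)
Definition counit2 {X Z : D} (f : hom X Z) :
    counit1 Z ∘ F @1 (U @1 f) ⟹ f ∘ counit1 X :=
  lift (mate_ext (U @1 f)) (act f (Phi X) • run' (U @1 f)).

Lemma push_counit2 {X Z : D} (f : hom X Z) :
  counit2 f ⊙ mate (U @1 f) = act f (Phi X) • run' (U @1 f).
Proof. apply (lift_push (mate_ext (U @1 f))). Qed.

Definition counit_data : colax_data (@on1 _ _ _ (comp_pf F U))
    (@on1 _ _ _ (id_pf D)) := {|
  cell1 := counit1;
  cell2 := fun X Z f => counit2 f
    : counit1 Z ∘ (comp_pf F U @1 f) ⟹ (id_pf D @1 f) ∘ counit1 X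
|}.

Lemma counit_laws : is_colax (H := comp_pf F U) (G := id_pf D) counit_data.
Proof.
  constructor.
  - intros X Z f f' θ. apply (extension_cancel (mate_ext (U @1 f))).
    change ((counit2 f' • (counit1 Z ◁ F @2 (U @2 θ))) ⊙ mate (U @1 f)
            = ((θ ▷ counit1 X) • counit2 f) ⊙ mate (U @1 f)).
    rewrite !push_comp, (push_mate (@push_on2)), <- push_pre, !push_counit2.
    rewrite <- push_pre, act_nat_l. pack. reflexivity.
  - intros X. apply (extension_cancel (mate_ext (U @1 (id1 X)))).
    change ((lun (counit1 X) • (idm (id1 X) ▷ counit1 X) • counit2 (id1 X))
              ⊙ mate (U @1 id1 X)
            = (run (counit1 X) • (counit1 X ◁ (iot F (U0 X) • F @2 (iot U X))))
              ⊙ mate (U @1 id1 X)).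
    rewrite hcomp_id, vcomp_idl, whl_comp, !push_comp.
    rewrite (push_mate (@push_on2)), push_counit2.
    rewrite <- !push_pre, act_id. unfold mate.
    rewrite <- !push_pre, paste_push_r, push_iot, paste_unit_r.
    pack. reflexivity.
  - intros X Y Z g f. apply (extension_cancel (mate_ext (U @1 (g ∘ f)))).
    change (((idm (g ∘ f) ▷ counit1 X) • counit2 (g ∘ f))
              ⊙ mate (U @1 (g ∘ f))
            = (asc _ _ _ • (g ◁ counit2 f) • asc' _ _ _
              • (counit2 g ▷ F @1 (U @1 f)) • asc _ _ _
              • (counit1 Z ◁ (gam F (U @1 g) (U @1 f) • F @2 (gam U g f))))
              ⊙ mate (U @1 (g ∘ f))).
    rewrite hcomp_id, vcomp_idl, whl_comp, !push_comp, (push_mate (@push_on2)).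
    rewrite <- !push_pre. rewrite (mate_counit (@push_gamF) (@push_counit2)).
    rewrite <- (push_comp (asc' _ _ _)), asc'_asc, push_id.
    rewrite act_nat_r, !push_counit2, act_pre, act_comp.
    rewrite <- !push_pre. pack. reflexivity.
Qed.

(** Both [eps F(y_A)] and the identity carry extensions of [y_A], the latter by
    the unit axiom, so that the comparison [Psi] is invertible. *)
Definition Psi (A : C) : counit1 (F0 A) ∘ F @1 (y A) ⟹ id1 (F0 A) :=
  lift (mate_ext (y A)) (unit_cell A).

Lemma push_Psi (A : C) : Psi A ⊙ mate (y A) = unit_cell A.
Proof. apply (lift_push (mate_ext (y A))). Qed.

Definition Psi_inv (A : C) : id1 (F0 A) ⟹ counit1 (F0 A) ∘ F @1 (y A) :=
  lift (unit_ext A) (mate (y A)).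

Lemma push_Psi_inv (A : C) : Psi_inv A ⊙ unit_cell A = mate (y A).
Proof. apply (lift_push (unit_ext A)). Qed.

Lemma Psi_inv_Psi (A : C) : Psi_inv A • Psi A = idm _.
Proof. exact (lift_inverse (mate_ext (y A)) (push_Psi A) (push_Psi_inv A)). Qed.

Lemma Psi_Psi_inv (A : C) : Psi A • Psi_inv A = idm _.
Proof. exact (lift_inverse (unit_ext A) (push_Psi_inv A) (push_Psi A)). Qed.

Definition eta_colax : colax (id_pf C) (comp_pf U F) := Colax eta_laws.
Definition counit : colax (comp_pf F U) (id_pf D) := Colax counit_laws.

Lemma mate_comp_gam' {A B : C} {Z : D} (g : hom B (U0 Z)) (f : hom A B) :
  (counit1 Z ◁ gam' F g f) ⊙ asc' _ _ _ ⊙ paste_ext (mate g) (eta f)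
  = mate (g ∘ f).
Proof.
  rewrite <- (mate_comp (@push_gamF)), <- (push_comp (asc' _ _ _)), asc'_asc, push_id.
  now rewrite <- push_comp, <- whl_comp, (gamK F_laws), hcomp_id, push_id.
Qed.

(** The universal property needed for 2-cells out of [eps F(y_B) ∘ F f], where the
    modification axiom of [Psi] is tested. *)
Lemma paste_mate_ext {A B : C} {Z : D} (g : hom B (U0 Z)) (f : hom A B) :
  is_U_extension (paste_ext (mate g) (eta f)).
Proof.
  refine (extension_iso (i := asc _ _ _ • (counit1 Z ◁ gam F g f)) _ _
    (mate_ext (g ∘ f))).
  - apply invertible_comp; [apply invertible_eqm|].
    apply invertible_hcomp; [apply invertible_idm | apply invertible_gam].
  - now rewrite push_comp, (mate_comp (@push_gamF)).
Qed.

Lemma Psi_law {A B : C} (f : hom A B) :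
  (F @1 f ◁ Psi A)
    • cell2 (comp_colax (whisk_r counit F) (whisk_l F eta_colax)) f
  = cell2 (id_colax (@on1 _ _ _ F)) f • (Psi B ▷ F @1 f).
Proof.
  apply (extension_cancel (paste_mate_ext (y B) f)).
  change (((F @1 f ◁ Psi A) • asc' _ _ _
           • (counit2 (F @1 f) ▷ F @1 (y A)) • asc _ _ _
           • (counit1 (F0 B) ◁ (gam F (U @1 (F @1 f)) (y A) • F @2 (eta f)
                • gam' F (y B) f)) • asc' _ _ _)
            ⊙ paste_ext (mate (y B)) (eta f)
          = ((run' (F @1 f) • lun (F @1 f)) • (Psi B ▷ F @1 f))
            ⊙ paste_ext (mate (y B)) (eta f)).
  rewrite !whl_comp, !push_comp, mate_comp_gam', (push_mate (@push_on2)).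
  rewrite <- !push_pre, (mate_counit (@push_gamF) (@push_counit2)).
  rewrite <- (push_comp (asc' _ _ _)), asc'_asc, push_id.
  rewrite act_nat_r, push_Psi, paste_push_l, push_Psi, paste_unit_l.
  now rewrite act_unit', push_pre, vcomp_idl.
Qed.

Lemma Psi_inv_law {A B : C} (f : hom A B) :
  (F @1 f ◁ Psi_inv A) • cell2 (id_colax (@on1 _ _ _ F)) f
  = cell2 (comp_colax (whisk_r counit F) (whisk_l F eta_colax)) f
    • (Psi_inv B ▷ F @1 f).
Proof.
  symmetry. refine (conj_inverse _ _ (Psi_law f)).
  - now rewrite <- whl_comp, Psi_inv_Psi, hcomp_id.
  - now rewrite <- whr_comp, Psi_Psi_inv, hcomp_id.
Qed.

Lemma Phi_law {A B : D} (f : hom A B) :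
  (U @1 f ◁ Phi A) • cell2 (id_colax (@on1 _ _ _ U)) f
  = cell2 (comp_colax (whisk_l U counit) (whisk_r eta_colax U)) f
    • (Phi B ▷ U @1 f).
Proof.
  change ((U @1 f ◁ Phi A) • run' (U @1 f) • lun (U @1 f)
          = (asc' _ _ _ • ((gam U f (counit1 A) • U @2 (counit2 f)
               • gam' U (counit1 B) (F @1 (U @1 f))) ▷ y (U0 A)) • asc _ _ _
              • (U @1 (counit1 B) ◁ eta (U @1 f)) • asc' _ _ _)
            • (Phi B ▷ U @1 f)).
  rewrite !whr_comp, <- !vcomp_assoc.
  change ((U @1 f ◁ Phi A) • run' (U @1 f) • lun (U @1 f)
          = asc' _ _ _ • (gam U f (counit1 A) ▷ y (U0 A))
            • counit2 f ⊙ paste_ext (Phi B) (eta (U @1 f))).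
  assert (E : counit2 f ⊙ paste_ext (Phi B) (eta (U @1 f))
              = act f (Phi A) • run' (U @1 f) • lun (U @1 f)).
  { rewrite (vcomp_assoc (act f _)), <- push_counit2. unfold mate.
    now rewrite !push_pre, <- vcomp_assoc, lun'_lun, vcomp_idr. }
  rewrite E. unfold act.
  rewrite <- !vcomp_assoc, (vcomp_assoc (gam U _ _ ▷ _)), <- whr_comp.
  rewrite (gam'K (pf_laws U)), hcomp_id, vcomp_idl.
  now rewrite (vcomp_assoc (asc' _ _ _)), asc'_asc, vcomp_idl.
Qed.

Lemma swallowtail_eta (A : C) :
  lun (y A)
    • ((iot U (F0 A) • U @2 (Psi A) • gam' U (counit1 (F0 A)) (F @1 y A)) ▷ y A)
    • asc (U @1 counit1 (F0 A)) (U @1 (F @1 y A)) (y A)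
    • ((U @1 counit1 (F0 A)) ◁ eta (y A))
    • asc' (U @1 counit1 (F0 A)) (y (U0 (F0 A))) (y A)
    • (Phi (F0 A) ▷ y A)
    • lun' (y A)
  = idm (y A).
Proof.
  rewrite !whr_comp, <- !vcomp_assoc.
  transitivity (lun (y A) • (iot U (F0 A) ▷ y A) • (Psi A ⊙ mate (y A))).
  - unfold mate, paste_ext, push. now rewrite <- !vcomp_assoc.
  - rewrite push_Psi. unfold unit_cell.
    rewrite (vcomp_assoc (iot U _ ▷ _)), <- whr_comp, (iot'K (pf_laws U)).
    now rewrite hcomp_id, vcomp_idl, lun_lun'.
Qed.

Lemma swallowtail_eps (B : D) :
  run (counit1 B)
    • (counit1 B ◁ Psi (U0 B))
    • asc' (counit1 B) (counit1 (F0 (U0 B))) (F @1 y (U0 B))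
    • (counit2 (counit1 B) ▷ (F @1 y (U0 B)))
    • asc (counit1 B) (F @1 (U @1 counit1 B)) (F @1 y (U0 B))
    • (counit1 B ◁ (gam F (U @1 counit1 B) (y (U0 B)) • F @2 (Phi B)
                    • iot' F (U0 B)))
    • run' (counit1 B)
  = idm (counit1 B).
Proof.
  apply (extension_cancel (Phi_ext B)).
  (* Up to the unit constraint of F, the extension of the identity is its mate. *)
  assert (E : (counit1 B ◁ iot' F (U0 B)) ⊙ run' (counit1 B) ⊙ Phi B
              = mate (id1 (U0 B))).
  { assert (E : (counit1 B ◁ iot F (U0 B)) ⊙ mate (id1 (U0 B))
                = run' (counit1 B) ⊙ Phi B).
    { unfold mate. rewrite <- push_pre, paste_push_r, push_iot.
      rewrite <- (push_id (paste_ext _ _)), <- run'_run, push_comp.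
      rewrite paste_unit_r. unfold push. pack. reflexivity. }
    rewrite <- E, <- push_comp, <- whl_comp, (iotK F_laws), hcomp_id.
    apply push_id. }
  rewrite !whl_comp, !push_comp, E, (push_mate (@push_on2)), <- !push_pre.
  rewrite (mate_counit (@push_gamF) (@push_counit2)).
  rewrite <- (push_comp (asc' _ _ _)), asc'_asc, push_id.
  rewrite act_nat_r, push_Psi, act_unit, vcomp_idl. now rewrite push_id.
Qed.

Definition Psi_mod :
    modification (comp_colax (whisk_r counit F) (whisk_l F eta_colax))
      (id_colax (@on1 _ _ _ F)) :=
  @Modification _ _ _ _ _ _ (comp_colax (whisk_r counit F) (whisk_l F eta_colax))
    (id_colax (@on1 _ _ _ F)) Psi (@Psi_law).

Definition Psi_inv_mod :
    modification (id_colax (@on1 _ _ _ F))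
      (comp_colax (whisk_r counit F) (whisk_l F eta_colax)) :=
  @Modification _ _ _ _ _ _ (id_colax (@on1 _ _ _ F))
    (comp_colax (whisk_r counit F) (whisk_l F eta_colax))
    Psi_inv (@Psi_inv_law).

Definition Phi_mod :
    modification (id_colax (@on1 _ _ _ U))
      (comp_colax (whisk_l U counit) (whisk_r eta_colax U)) :=
  @Modification _ _ _ _ _ _ (id_colax (@on1 _ _ _ U))
    (comp_colax (whisk_l U counit) (whisk_r eta_colax U)) Phi (@Phi_law).

Definition adjunction : colax_adjunction F U := {|
  adj_unit := eta_colax;
  adj_counit := counit;
  adj_Psi := Psi_mod;
  adj_Phi := Phi_mod;
  swallowtail_unit := swallowtail_eta;
  swallowtail_counit := swallowtail_eps
|}.

Lemma extensions_adjunction :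
  exists (F : pseudofunctor F0) (adj : colax_adjunction F U),
    invertible_modification (adj_Psi adj) /\ forall A : C, adj_unit adj A = y A.
Proof.
  exists F, adjunction. split; [|reflexivity].
  exists Psi_inv_mod.
  intros A. split; [apply Psi_inv_Psi | apply Psi_Psi_inv].
Qed.

End FromExtensions.

End FromExtensions.

(** * From a colax adjunction to U-extensions *)

Section FromAdjunction.
Context {D C : two_category} {U0 : D -> C} {U : pseudofunctor U0}
  {F0 : C -> D} {F : pseudofunctor F0} (adj : colax_adjunction F U).

(** The components of the adjunction get types stated through [F] and [U] alone,
    without composite pseudofunctors, so that the laws of pasting apply to them. *)
Definition unit1 (A : C) : hom A (U0 (F0 A)) := adj_unit adj A.
Definition unit2 {A B : C} (f : hom A B) :
    unit1 B ∘ f ⟹ (U @1 (F @1 f)) ∘ unit1 A := cell2 (adj_unit adj) f.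
Definition eps1 (Z : D) : hom (F0 (U0 Z)) Z := adj_counit adj Z.
Definition eps2 {X Z : D} (f : hom X Z) :
    eps1 Z ∘ F @1 (U @1 f) ⟹ f ∘ eps1 X := cell2 (adj_counit adj) f.
Definition tri1 (A : C) : eps1 (F0 A) ∘ F @1 (unit1 A) ⟹ id1 (F0 A) :=
  adj_Psi adj A.
Definition tri2 (Z : D) : id1 (U0 Z) ⟹ (U @1 (eps1 Z)) ∘ unit1 (U0 Z) :=
  adj_Phi adj Z.

Local Notation mate :=
  (mate (F := F) (eta := @unit2) (eps := eps1) (Phi := tri2)).

Lemma unit_on2 {A B : C} {f f' : hom A B} (a : f ⟹ f') :
  F @2 a ⊙ unit2 f = unit2 f' • (unit1 B ◁ a).
Proof. symmetry. apply (colax_nat (colax_laws (adj_unit adj))). Qed.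

Lemma unit_gam {A B E : C} (g : hom B E) (f : hom A B) :
  gam F g f ⊙ unit2 (g ∘ f) = paste_ext (unit2 g) (unit2 f) • asc _ g f.
Proof.
  assert (L : ((gam U (F @1 g) (F @1 f) • U @2 (gam F g f)) ▷ unit1 A)
                • unit2 (g ∘ f)
              = asc _ _ _ • (_ ◁ unit2 f) • asc' _ _ _ • (unit2 g ▷ f)
                • asc _ _ _ • (unit1 E ◁ idm (g ∘ f)))
    by apply (colax_comp (colax_laws (adj_unit adj))).
  rewrite hcomp_id, vcomp_idr, whr_comp, <- vcomp_assoc in L.
  unfold paste_ext. rewrite <- !vcomp_assoc, <- L, vcomp_assoc, <- whr_comp.
  now rewrite (gamK (pf_laws U)), hcomp_id, vcomp_idl.
Qed.

Lemma eps_nat {X Z : D} {f f' : hom X Z} (θ : f ⟹ f') :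
  eps2 f' • (eps1 Z ◁ F @2 (U @2 θ)) = (θ ▷ eps1 X) • eps2 f.
Proof. apply (colax_nat (colax_laws (adj_counit adj))). Qed.

Lemma eps_comp {X Y Z : D} (g : hom Y Z) (f : hom X Y) :
  eps2 (g ∘ f) • (eps1 Z ◁ F @2 (gam' U g f))
  = asc _ _ _ • (g ◁ eps2 f) • asc' _ _ _ • (eps2 g ▷ F @1 (U @1 f))
    • asc _ _ _ • (eps1 Z ◁ gam F (U @1 g) (U @1 f)).
Proof.
  assert (L : (idm (g ∘ f) ▷ eps1 X) • eps2 (g ∘ f)
    = asc _ _ _ • (g ◁ eps2 f) • asc' _ _ _ • (eps2 g ▷ F @1 (U @1 f))
      • asc _ _ _ • (eps1 Z ◁ (gam F (U @1 g) (U @1 f) • F @2 (gam U g f))))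
    by apply (colax_comp (colax_laws (adj_counit adj))).
  rewrite hcomp_id, vcomp_idl, whl_comp in L. rewrite L.
  rewrite <- !vcomp_assoc, <- whl_comp, <- pf_comp, (gam'K (pf_laws U)).
  now rewrite pf_id, hcomp_id, vcomp_idr.
Qed.

Lemma tri1_mod {A B : C} (f : hom A B) :
  (F @1 f ◁ tri1 A) • asc' _ _ _ • (eps2 (F @1 f) ▷ F @1 (unit1 A)) • asc _ _ _
    • (eps1 (F0 B) ◁ (gam F (U @1 (F @1 f)) (unit1 A) • F @2 (unit2 f)))
  = run' (F @1 f) • lun (F @1 f) • (tri1 B ▷ F @1 f) • asc _ _ _
    • (eps1 (F0 B) ◁ gam F (unit1 B) f).
Proof.
  assert (L : (F @1 f ◁ tri1 A) • asc' _ _ _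
      • (eps2 (F @1 f) ▷ F @1 (unit1 A)) • asc _ _ _
      • (eps1 (F0 B) ◁ (gam F (U @1 (F @1 f)) (unit1 A) • F @2 (unit2 f)
           • gam' F (unit1 B) f)) • asc' _ _ _
    = (run' (F @1 f) • lun (F @1 f)) • (tri1 B ▷ F @1 f))
    by apply (mod_law (adj_Psi adj)).
  rewrite (vcomp_assoc (lun _)), (vcomp_assoc (run' _)), (vcomp_assoc (run' _)).
  rewrite <- L, <- !vcomp_assoc, (vcomp_assoc (asc' _ _ _) (asc _ _ _)).
  rewrite asc'_asc, vcomp_idl, <- whl_comp, <- !vcomp_assoc.
  now rewrite (gamK (pf_laws F)), vcomp_idr.
Qed.

Lemma tri2_mod {X Z : D} (f : hom X Z) :
  eps2 f ⊙ mate (U @1 f) = act f (tri2 X) • run' (U @1 f).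
Proof.
  assert (L : (U @1 f ◁ tri2 X) • run' (U @1 f) • lun (U @1 f)
     = (asc' _ _ _ • ((gam U f (eps1 X) • U @2 (eps2 f)
               • gam' U (eps1 Z) (F @1 (U @1 f))) ▷ unit1 (U0 X)) • asc _ _ _
              • (U @1 (eps1 Z) ◁ unit2 (U @1 f)) • asc' _ _ _)
            • (tri2 Z ▷ U @1 f))
    by apply (mod_law (adj_Phi adj)).
  unfold act. rewrite <- !vcomp_assoc.
  apply (f_equal (fun z => z • lun' (U @1 f))) in L.
  rewrite <- !vcomp_assoc, lun_lun', vcomp_idr in L. rewrite L.
  unfold mate, paste_ext, push.
  rewrite !whr_comp, <- !vcomp_assoc, (vcomp_assoc (asc _ _ _) (asc' _ _ _)).
  rewrite asc_asc', vcomp_idl, (vcomp_assoc (gam' U _ _ ▷ _) (gam U _ _ ▷ _)).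
  now rewrite <- whr_comp, (gamK (pf_laws U)), hcomp_id, vcomp_idl.
Qed.

(** The first swallowtail identity. *)
Lemma tri1_mate (A : C) : tri1 A ⊙ mate (unit1 A) = unit_cell A.
Proof.
  assert (L : lun (unit1 A)
    • ((iot U (F0 A) • U @2 (tri1 A) • gam' U (eps1 (F0 A)) (F @1 unit1 A))
        ▷ unit1 A)
    • asc (U @1 eps1 (F0 A)) (U @1 (F @1 unit1 A)) (unit1 A)
    • ((U @1 eps1 (F0 A)) ◁ unit2 (unit1 A))
    • asc' (U @1 eps1 (F0 A)) (unit1 (U0 (F0 A))) (unit1 A)
    • (tri2 (F0 A) ▷ unit1 A)
    • lun' (unit1 A)
    = idm (unit1 A)) by apply (swallowtail_unit adj).
  apply (f_equal (fun z => unit_cell (U := U) (y := unit1) A • z)) in L.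
  rewrite vcomp_idr in L. rewrite <- L at 1. unfold unit_cell.
  rewrite !whr_comp, <- !vcomp_assoc.
  rewrite (vcomp_assoc (lun' _) (lun _)), lun'_lun, vcomp_idl.
  rewrite (vcomp_assoc (iot' U _ ▷ _) (iot U _ ▷ _)), <- whr_comp.
  rewrite (iotK (pf_laws U)), hcomp_id, vcomp_idl.
  unfold mate, paste_ext, push. now rewrite <- !vcomp_assoc.
Qed.

(** The inverse correspondence to [θ |-> θ ⊙ mate f]. *)
Definition transpose {A : C} {Z : D} {f : hom A (U0 Z)} {g : hom (F0 A) Z}
    (α : f ⟹ (U @1 g) ∘ unit1 A) : eps1 Z ∘ F @1 f ⟹ g :=
  run g • (g ◁ tri1 A) • asc' _ _ _ • (eps2 g ▷ F @1 (unit1 A)) • asc _ _ _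
    • (eps1 Z ◁ (gam F (U @1 g) (unit1 A) • F @2 α)).

(** The second swallowtail identity, with the unit constraint of [F] moved to the
    other side. *)
Lemma transpose_tri2 (Z : D) :
  transpose (tri2 Z) = run (eps1 Z) • (eps1 Z ◁ iot F (U0 Z)).
Proof.
  assert (L : run (eps1 Z)
    • (eps1 Z ◁ tri1 (U0 Z))
    • asc' (eps1 Z) (eps1 (F0 (U0 Z))) (F @1 unit1 (U0 Z))
    • (eps2 (eps1 Z) ▷ (F @1 unit1 (U0 Z)))
    • asc (eps1 Z) (F @1 (U @1 eps1 Z)) (F @1 unit1 (U0 Z))
    • (eps1 Z ◁ (gam F (U @1 eps1 Z) (unit1 (U0 Z)) • F @2 (tri2 Z)
                    • iot' F (U0 Z)))
    • run' (eps1 Z)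
    = idm (eps1 Z)) by apply (swallowtail_counit adj).
  apply (f_equal (fun z => z • run _ • (eps1 Z ◁ iot F (U0 Z)))) in L.
  rewrite vcomp_idl in L. rewrite <- L, <- !vcomp_assoc.
  rewrite (vcomp_assoc (run' _) (run _)), run'_run, vcomp_idl.
  rewrite <- (whl_comp (eps1 Z) _ (iot F _)), <- !vcomp_assoc.
  now rewrite (iotK (pf_laws F)), vcomp_idr.
Qed.

(** The modification axiom of [Psi]; the right-hand side shows that this 2-cell,
    comparing [eps F(y_B f)] with [F f], is invertible as soon as [Psi] is. *)
Lemma transpose_unit2 {A B : C} (f : hom A B) :
  transpose (unit2 f)
  = lun _ • (tri1 B ▷ F @1 f) • asc _ _ _ • (eps1 (F0 B) ◁ gam F (unit1 B) f).
Proof.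
  unfold transpose. rewrite tri1_mod.
  now rewrite (vcomp_assoc (run _) (run' _)), run_run', vcomp_idl.
Qed.

(** Existence in the universal property, by the first swallowtail identity. *)
Lemma transpose_mate {A : C} {Z : D} {f : hom A (U0 Z)} {g : hom (F0 A) Z}
    (α : f ⟹ (U @1 g) ∘ unit1 A) : transpose α ⊙ mate f = α.
Proof.
  unfold transpose. rewrite !whl_comp, !push_comp, (push_mate (@unit_on2)).
  rewrite <- !push_pre, (mate_counit (@unit_gam) (@tri2_mod)).
  rewrite <- (push_comp (asc' _ _ _)), asc'_asc, push_id.
  now rewrite act_nat_r, tri1_mate, act_unit, vcomp_idl.
Qed.

Lemma transpose_pre {A : C} {Z : D} {f f' : hom A (U0 Z)} {g : hom (F0 A) Z}
    (α : f ⟹ (U @1 g) ∘ unit1 A) (β : f' ⟹ f) :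
  transpose (α • β) = transpose α • (eps1 Z ◁ F @2 β).
Proof.
  unfold transpose. now rewrite pf_comp, !whl_comp, <- !vcomp_assoc.
Qed.

Lemma transpose_push {A : C} {Z : D} {f : hom A (U0 Z)} {g g' : hom (F0 A) Z}
    (θ : g ⟹ g') (α : f ⟹ (U @1 g) ∘ unit1 A) :
  transpose (θ ⊙ α) = θ • transpose α.
Proof.
  unfold transpose, push. pack.
  prw (f_equal (fun z => eps1 Z ◁ z)
         (gam_nat (pf_laws F) (U @2 θ) (idm (unit1 A)))).
  prw (f_equal (fun z => z ▷ F @1 (unit1 A)) (eps_nat θ)).
  prw (eq_sym (slide θ (tri1 A))).
  reflexivity.
Qed.

(** Transposition of an action splits, by the composition axiom of the counit and
    the associativity of [F]. *)
Lemma transpose_act {A : C} {Z W : D} (m : hom Z W) {h : hom A (U0 Z)}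
    {k : hom (F0 A) Z} (τ : h ⟹ (U @1 k) ∘ unit1 A) :
  transpose (act m τ)
  = (m ◁ transpose τ) • asc' _ _ _ • (eps2 m ▷ F @1 h) • asc _ _ _
    • (eps1 W ◁ gam F (U @1 m) h).
Proof.
  unfold transpose, act. pack.
  prw (f_equal (fun z => eps1 W ◁ z)
    (gam_nat (pf_laws F) (gam' U m k) (idm (unit1 A)))).
  prw (f_equal (fun z => z ▷ F @1 (unit1 A)) (eps_comp m k)).
  prw (f_equal (fun z => eps1 W ◁ z)
    (gam_assoc (pf_laws F) (U @1 m) (U @1 k) (unit1 A))).
  prw (f_equal (fun z => eps1 W ◁ z)
    (gam_nat (pf_laws F) (idm (U @1 m)) τ)).
  prw (slide (eps2 m) (gam F (U @1 k) (unit1 A) • F @2 τ)).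
  reflexivity.
Qed.

Lemma gam_id_l {A B : C} (f : hom A B) :
  gam F (id1 B) f = (iot' F B ▷ F @1 f) • lun' _ • F @2 (lun f).
Proof.
  rewrite <- (gam_idl (pf_laws F)), (vcomp_assoc (lun' _)), lun'_lun, vcomp_idl.
  now rewrite vcomp_assoc, <- whr_comp, (iotK (pf_laws F)), hcomp_id, vcomp_idl.
Qed.

(** Uniqueness in the universal property rests on this triangle identity.  The mate
    of [f] is a pasting of [Phi] with the unit at [f]; transposing it in two steps
    leaves the second swallowtail identity whiskered by [F f]. *)
Lemma transpose_mate_id {A : C} {Z : D} (f : hom A (U0 Z)) :
  transpose (mate f) = idm _.
Proof.
  unfold mate. rewrite paste_extE, <- vcomp_assoc, transpose_pre.
  rewrite transpose_act, transpose_unit2.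
  assert (L := transpose_tri2 Z).
  apply (f_equal (fun z => z • (eps1 Z ◁ iot' F (U0 Z)))) in L.
  rewrite <- (vcomp_assoc (run _)), <- whl_comp, (iot'K (pf_laws F)) in L.
  rewrite hcomp_id, vcomp_idr in L. unfold transpose in L.
  pack.
  (* Move the constraint of F on y f past the counit at eps, then collect the
     factor F f on the right. *)
  prw (eq_sym (slide (eps2 (eps1 Z)) (gam F (unit1 (U0 Z)) f))).
  prw (f_equal (fun z => eps1 Z ◁ z)
    (eq_sym (gam_assoc (pf_laws F) (U @1 eps1 Z) (unit1 (U0 Z)) f))).
  prw (f_equal (fun z => eps1 Z ◁ z)
    (gam_nat (pf_laws F) (tri2 Z) (idm f))).
  prw (f_equal (fun z => eps1 Z ◁ z) (gam_id_l f)).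
  prw (f_equal (fun z => z ▷ F @1 f) L).
  reflexivity.
Qed.

Lemma mate_ext {A : C} {Z : D} (f : hom A (U0 Z)) : is_U_extension (mate f).
Proof.
  intros g α. exists (transpose α). split; [apply transpose_mate|].
  intros θ <-. change (transpose (θ ⊙ mate f) = θ).
  now rewrite transpose_push, transpose_mate_id, vcomp_idr.
Qed.

Definition adjoint_extensions : chosen_U_extensions U unit1 := {|
  ext := fun A Z f => eps1 Z ∘ F @1 f;
  ext_cell := fun A Z f => mate f;
  ext_universal := @mate_ext
|}.

Context (Hinv : invertible_modification (adj_Psi adj)).

Lemma invertible_tri1 (A : C) : invertible (tri1 A).
Proof. destruct Hinv as [Δ HΔ]. exists (Δ A). apply HΔ. Qed.

Lemma invertible_transpose_tri2 (Z : D) : invertible (transpose (tri2 Z)).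
Proof.
  rewrite transpose_tri2. apply invertible_comp; [apply invertible_eqm|].
  apply invertible_hcomp; [apply invertible_idm | apply invertible_iot].
Qed.

Lemma invertible_transpose_unit2 {A B : C} (f : hom A B) :
  invertible (transpose (unit2 f)).
Proof.
  rewrite transpose_unit2.
  apply invertible_comp; [apply invertible_eqm|].
  apply invertible_comp.
  { apply invertible_hcomp; [apply invertible_tri1 | apply invertible_idm]. }
  apply invertible_comp; [apply invertible_eqm|].
  apply invertible_hcomp; [apply invertible_idm | apply invertible_gam].
Qed.

(** The transposes of [Phi] and of the unit at [f] are invertible and push the
    pasting of the two mates to the pasting of [Phi] with the unit at [f], which is
    the mate of [f]. *)
Lemma adjoint_coherent : coherent_choice adjoint_extensions.
Proof.
  intros A Z f.
  refine (extension_iso_inv (invertible_hcomp (invertible_transpose_tri2 Z)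
    (invertible_transpose_unit2 f)) _ (mate_ext f)).
  rewrite <- push_pre. cbn. now rewrite paste_push, !transpose_mate.
Qed.

Lemma adjoint_unit_axiom : unit_axiom U unit1.
Proof.
  intros A.
  exact (extension_iso (invertible_tri1 A) (tri1_mate A) (mate_ext (unit1 A))).
Qed.

Lemma unit2_comp_ext {A B E : C} (g : hom B E) (f : hom A B) :
  is_U_extension (unit2 (g ∘ f) • asc' (unit1 E) g f).
Proof.
  refine (extension_iso _ (transpose_mate _) (mate_ext (unit1 E ∘ g ∘ f))).
  rewrite transpose_pre.
  apply invertible_comp; [apply invertible_transpose_unit2|].
  apply invertible_hcomp; [apply invertible_idm|].
  apply invertible_on2, invertible_eqm.
Qed.

(** The same transposes push the pasting of the mates of [y g] and [y f] to that of
    the units at [g] and [f], and this is the unit at [g ∘ f] up to [gam F g f]. *)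
Lemma adjoint_composition : composition_axiom adjoint_extensions.
Proof.
  intros A B E f g.
  refine (extension_iso_inv (invertible_hcomp (invertible_transpose_unit2 g)
    (invertible_transpose_unit2 f)) _
    (extension_iso (invertible_gam F g f) eq_refl (unit2_comp_ext g f))).
  rewrite <- push_pre, unit_gam, <- vcomp_assoc, asc_asc', vcomp_idr.
  cbn. now rewrite paste_push, !transpose_mate.
Qed.

End FromAdjunction.

(** * The equivalence *)

Theorem theorem3p5 (D C : two_category) (U0 : D -> C) (U : pseudofunctor U0)
    (F0 : C -> D) (y : forall A : C, hom A (U0 (F0 A))) :
  (exists d : chosen_U_extensions U y,
      coherent_choice d /\ unit_axiom U y /\ composition_axiom d)
  <->
  (exists (F : pseudofunctor F0) (adj : colax_adjunction F U),
      invertible_modification (adj_Psi adj) /\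
      forall A : C, adj_unit adj A = y A).
Proof.
  split.
  - intros (d & Hcoh & Hunit & Hcomp).
    exact (FromExtensions.extensions_adjunction Hcoh Hunit Hcomp).
  - intros (F & adj & Hinv & Hy).
    assert (E : unit1 adj = y) by now apply functional_extensionality_dep.
    destruct E. exists (adjoint_extensions adj). split; [|split].
    + apply adjoint_coherent, Hinv.
    + apply adjoint_unit_axiom, Hinv.
    + apply adjoint_composition, Hinv.
Qed.
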